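(* Let $k,s\in\omega$. Let $\Gamma$ be the class of (locally finite) $k$-colorable graphs and $\Pi$ the problem of proper $(k(s+1)-s)$-coloring. Then $(\Pi,\Gamma)\in\textnormal{ASI}_c(s)$.
   Context: All graphs are locally finite. HF denotes the set of hereditarily finite sets. A coloring problem $(\Pi,\Gamma)$ consists of a class $\Gamma$ of (structured) graphs, closed under isomorphism and such that $G\in\Gamma$ iff every connected component of $G$ is in $\Gamma$, and a class $\Pi$ of functions $V(G)\to\textnormal{HF}$ ($G\in\Gamma$), closed under pushforward by isomorphisms and such that $c\in\Pi$ iff its restriction to each component is in $\Pi$. An ASI-$s$ algorithm is a function $\mathcal{A}$ which, on input $(H,<,U_0,\dots,U_s,C)$ where $H$ is a finite graph, $<$ a linear order on $V(H)$, $U_0,\dots,U_s$ a partition of $V(H)$, and $C\subseteq V(H)$, returns a function $C\to\textnormal{HF}$, such that for any isomorphism $\phi$ of such input structures, $\mathcal{A}(\text{input})=\mathcal{A}(\phi(\text{input}))\circ(\phi\upharpoonright C)$. It is computable if it is computable as a function on (canonical HF codes of) its inputs. For a graph $G$ with path metric $\rho_G$ and $r\in\omega$, $G^r$ is the graph on $V(G)$ joining distinct $x,y$ with $\rho_G(x,y)\le r$. An ASI-$s$ witness for $G$ with scale $r$ is a partition $U_0,\dots,U_s$ of $V(G)$ such that every connected component of each $G^r\upharpoonright U_i$ is finite. Given such a witness and a linear order $<$ on $V(G)$, let $\mathcal{C}$ be the disjoint set of all components of all $G^r\upharpoonright U_i$, and $\tilde G$ the graph on $\mathcal{C}$ joining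 $C\neq D$ when $\rho_G(C,D)\le r$. For $n\in\omega$, $\mathcal{A}_n[(G,<,U_0,\dots,U_s)]$ colors each $C\in\mathcal{C}$ by $\mathcal{A}(G\upharpoonright W,<\upharpoonright W,U_0\cap W,\dots,U_s\cap W,C)$, where $W=\bigcup\{D\in\mathcal{C}:\rho_{\tilde G}(C,D)\le n\}$. $(\Pi,\Gamma)\in\textnormal{ASI}_c(s)$ if there are a computable ASI-$s$ algorithm $\mathcal{A}$ and $n,r\in\omega$ such that for every $G\in\Gamma$, every linear order $<$ on $V(G)$ and every ASI-$s$ witness for $G$ with scale $r$, $\mathcal{A}_n[(G,<,U_0,\dots,U_s)]\in\Pi$. *)

(* Defs.v *)
From HB Require Import structures.
From mathcomp Require Import all_boot finmap.
From mathcomp Require Import boolp classical_sets functions cardinality.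

Set Implicit Arguments.
Unset Strict Implicit.
Unset Printing Implicit Defensive.

Local Open Scope classical_set_scope.

(** * Hereditarily finite sets *)

(* The Ackermann coding x |-> \sum_(y in x) 2 ^ (code of y) is an isomorphism
   of (HF, in) onto nat with the relation "bit x of y is 1"; a hereditarily
   finite set is identified with its Ackermann code. *)
Definition HF := nat.

Definition hf_mem (x y : HF) : bool := odd (y %/ 2 ^ x).

(* Junk value (the empty set) when S is infinite. *)
Definition hf_of (S : set HF) : HF := \sum_(x <- fset_set S) 2 ^ x.

Definition hf_pair (a b : HF) : HF :=
  hf_of [set hf_of [set a]; hf_of [set a; b]].

(* (a_1, ..., a_m) = (a_1, (a_2, (..., (a_m, 0)))). *)
Definition hf_tuple (l : seq HF) : HF := foldr hf_pair (hf_of set0) l.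

(* The von Neumann numeral: n.+1 is n `|` {n}. *)
Fixpoint hf_nat (n : nat) : HF :=
  if n is m.+1 then hf_of [set x | hf_mem x (hf_nat m) \/ x = hf_nat m]
  else hf_of set0.

Lemma hf_mem_sum (s : seq nat) (x : nat) :
  uniq s -> hf_mem x (\sum_(y <- s) 2 ^ y) = (x \in s).
Proof.
move=> us; rewrite /hf_mem.
have split3 : \sum_(y <- s) 2 ^ y = \sum_(y <- s | y < x) 2 ^ y
    + ((x \in s) + (\sum_(y <- s | x < y) 2 ^ (y - x.+1)).*2) * 2 ^ x.
  rewrite (bigID (fun y => y < x)) /=; congr (_ + _).
  rewrite (bigID (fun y => y == x)) /= mulnDl; congr (_ + _).
    rewrite (eq_bigl (fun y => y == x)); last first.
      by move=> y; case: ltngtP.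
    have [xs|xs] := boolP (x \in s).
      rewrite big_mkcond (bigD1_seq x) //= eqxx big1 ?addn0 ?mul1n//.
      by move=> i /negbTE->.
    rewrite mul0n big_seq_cond big1// => i /andP[is_ /eqP ix].
    by rewrite ix (negbTE xs) in is_.
  rewrite -muln2 !big_distrl /=; apply: eq_big => y; first by case: ltngtP.
  rewrite -leqNgt => /andP[xy nxy].
  have xy' : x < y by rewrite ltn_neqAle eq_sym nxy xy.
  by rewrite -mulnA -expnS -expnD subnK.
have low : \sum_(y <- s | y < x) 2 ^ y < 2 ^ x.
  have : \sum_(y <- s | y < x) 2 ^ y <= \sum_(0 <= y < x) 2 ^ y.
    rewrite -big_filter -[leqRHS]big_filter.
    set f := [seq i <- index_iota 0 x | true].
    have uf : uniq [seq i <- s | i < x] by rewrite filter_uniq.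
    rewrite (perm_big [seq i <- f | i \in [seq i <- s | i < x]]) /=.
      by rewrite big_filter [leqRHS](bigID (mem [seq i <- s | i < x])) /= leq_addr.
    apply: uniq_perm => //.
      by rewrite filter_uniq// filter_uniq// iota_uniq.
    move=> i; rewrite !mem_filter mem_index_iota leq0n /=.
    by case: (i < x); rewrite ?andbT ?andbF.
  move=> h; apply: (leq_ltn_trans h); rewrite big_mkord.
  by have := predn_exp 2 x; rewrite mul1n => <-; rewrite prednK// expn_gt0.
by rewrite split3 addnC divnMDl ?expn_gt0// divn_small// addn0 oddD odd_double addbF
  oddb.
Qed.

Lemma hf_mem_of (S : set HF) x : finite_set S -> hf_mem x (hf_of S) <-> S x.
Proof.
move=> fS; rewrite /hf_of hf_mem_sum ?fset_uniq//.
by rewrite in_fset_set// inE.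
Qed.

Lemma hf_mem_lt x y : hf_mem x y -> x < y.
Proof.
rewrite /hf_mem => h; rewrite ltnNge; apply/negP => yx.
by move: h; rewrite divn_small// (leq_ltn_trans yx)// ltn_expl.
Qed.

Lemma hf_ext x y : (forall z, hf_mem z x = hf_mem z y) -> x = y.
Proof.
elim/ltn_ind: x y => x IH y h.
have h0 : odd x = odd y by have := h 0; rewrite /hf_mem expn0 !divn1.
have hS z : hf_mem z x./2 = hf_mem z y./2.
  by have := h z.+1; rewrite /hf_mem expnS !divnMA !divn2.
have [x0|x0] := posnP x.
  subst x; apply/esym/eqP; rewrite -leqn0 leqNgt; apply/negP => y0.
  have := h (trunc_log 2 y); rewrite {1}/hf_mem div0n /= => /esym.
  rewrite /hf_mem (_ : y %/ _ = 1)//; apply/eqP.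
  have /andP[l u] := trunc_log_bounds (isT : 1 < 2) y0.
  by rewrite eqn_leq -ltnS ltn_divLR ?expn_gt0// -expnS u/= divn_gt0 ?expn_gt0.
rewrite -(odd_double_half x) -(odd_double_half y) h0 (IH x./2 _ y./2)//.
by rewrite -divn2 ltn_Pdiv.
Qed.

Lemma hf_finite x : finite_set [set y | hf_mem y x].
Proof. by apply: (@sub_finite_set _ _ `I_x) => // y /=; exact: hf_mem_lt. Qed.

Lemma hf_mem_nat q x : hf_mem x (hf_nat q) <-> exists2 i, i < q & x = hf_nat i.
Proof.
elim: q x => [|q IH] x /=.
  by rewrite hf_mem_of//; split=> // -[].
rewrite hf_mem_of; last first.
  rewrite (_ : [set _ | _] = [set y | hf_mem y (hf_nat q)] `|` [set hf_nat q])//.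
  by rewrite finite_setU; split => //; exact: hf_finite.
split=> [[/IH[i iq ->]|->]|[i]].
- by exists i => //; rewrite ltnS ltnW.
- by exists q.
- rewrite ltnS leq_eqVlt => /orP[/eqP->|iq] ->; first by right.
  by left; apply/IH; exists i.
Qed.

(** * Computability: partial recursive functions *)

(* [rprec f g] is primitive recursion on the first argument, and [rmu f]
   minimisation on the first argument. *)
Inductive recf : nat -> Type :=
| rzero n : recf n
| rsucc : recf 1
| rproj n (i : 'I_n) : recf n
| rcomp m n (f : recf m) (g : 'I_m -> recf n) : recf n
| rprec n (f : recf n) (g : recf n.+2) : recf n.+1
| rmu n (f : recf n.+1) : recf n.

(* [reval f v y]: f converges on the arguments v, with value y. *)
Fixpoint reval n (f : recf n) : n.-tuple nat -> nat -> Prop :=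
  match f with
  | rzero _ => fun _ y => y = 0
  | rsucc => fun v y => y = (thead v).+1
  | rproj _ i => fun v y => y = tnth v i
  | rcomp m _ f g => fun v y => exists2 w : m.-tuple nat,
      forall i, reval (g i) v (tnth w i) & reval f w y
  | rprec _ f g => fun v y => exists h : nat -> nat,
      [/\ reval f [tuple of behead v] (h 0),
          forall j, j < thead v ->
            reval g [tuple of j :: h j :: behead v] (h j.+1)
        & y = h (thead v)]
  | rmu _ f => fun v y => reval f [tuple of y :: v] 0 /\
      forall j, j < y -> exists z, reval f [tuple of j :: v] z.+1
  end.

Lemma reval_fun n (f : recf n) v y z : reval f v y -> reval f v z -> y = z.
Proof.
elim: f v y z => {n}
  [n|| n i|m n f IHf g IHg|n f IHf g IHg|n f IHf] v y z /=; try by move=> -> ->.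
- move=> [w hw fw] [w' hw' fw']; apply: IHf fw _.
  rewrite (_ : w = w')//; apply: eq_from_tnth => i; exact: IHg (hw i) (hw' i).
- move=> [h [h0 hS ->]] [h' [h0' hS' ->]].
  suff : forall j, j <= thead v -> h j = h' j by apply.
  elim=> [_|j IH jv]; first exact: IHf h0 h0'.
  have e := IH (ltnW jv); have := hS' j jv; rewrite -e; exact: IHg (hS j jv).
- move=> [fy hy] [fz hz]; case: (ltngtP y z) => // [/hz|/hy] [t ht].
    by have := IHf _ _ _ fy ht.
  by have := IHf _ _ _ fz ht.
Qed.

(** * Graphs *)

Record graph := Graph {
  vertex :> Type;
  adj : vertex -> vertex -> Prop;
  adj_sym : forall x y, adj x y -> adj y x;
  adj_irr : forall x, ~ adj x x }.

Definition locally_finite (G : graph) : Prop :=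
  forall x : G, finite_set [set y | adj x y].

Definition graph_iso (G H : graph) (phi : G -> H) : Prop :=
  bijective phi /\ forall x y, adj x y <-> adj (phi x) (phi y).

Section Induced.
Variables (G : graph) (W : set G).
Let iadj (x y : W) := adj (val x) (val y).
Fact induced_sym x y : iadj x y -> iadj y x. Proof. exact: adj_sym. Qed.
Fact induced_irr x : ~ iadj x x. Proof. exact: adj_irr. Qed.
Definition induced : graph := Graph induced_sym induced_irr.
End Induced.

Fixpoint walk (G : graph) (n : nat) (x y : G) : Prop :=
  if n is m.+1 then exists z, adj x z /\ walk m z y else x = y.

Definition connected (G : graph) (x y : G) : Prop := exists n, walk n x y.

Definition is_component (G : graph) (C : set G) : Prop :=
  exists x, C = [set y | connected x y].

(* The path metric; None stands for an infinite distance. *)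
Definition rho (G : graph) (x y : G) : option nat :=
  match pselect (exists n, `[< walk n x y >]) with
  | left h => Some (ex_minn h)
  | right _ => None
  end.

Definition rho_le (G : graph) (n : nat) (x y : G) : bool :=
  if rho x y is Some d then d <= n else false.

Lemma rho_leP (G : graph) n (x y : G) :
  rho_le n x y <-> exists2 m, m <= n & walk m x y.
Proof.
rewrite /rho_le /rho; case: pselect => [h|h].
  case: ex_minnP => d /asboolP wd dmin; split=> [dn|[m mn wm]]; first by exists d.
  by apply: leq_trans mn; apply: dmin; apply/asboolP.
by split=> // -[m _ wm]; case: h; exists m; apply/asboolP.
Qed.

Lemma walk_cat (G : graph) m n (x y z : G) :
  walk m x y -> walk n y z -> walk (m + n) x z.
Proof.
elim: m x => [|m IH] x /=; first by move=> ->.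
by move=> [t [xt ty]] yz; exists t; split=> //; exact: IH.
Qed.

Lemma walk_sym (G : graph) n (x y : G) : walk n x y -> walk n y x.
Proof.
elim: n x y => [|n IH] x y //= [z [xz /IH zy]].
suff : walk (n + 1) y x by rewrite addn1.
by apply: walk_cat zy _; exists x; split => //; exact: adj_sym.
Qed.

Lemma connected_refl (G : graph) (x : G) : connected x x.
Proof. by exists 0. Qed.

Lemma connected_sym (G : graph) (x y : G) : connected x y -> connected y x.
Proof. by move=> [n /walk_sym]; exists n. Qed.

Lemma connected_trans (G : graph) (x y z : G) :
  connected x y -> connected y z -> connected x z.
Proof. by move=> [m xy] [n yz]; exists (m + n); exact: walk_cat yz. Qed.

Lemma component_eq (G : graph) (C : set G) x :
  is_component C -> C x -> C = [set y | connected x y].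
Proof.
move=> [z ->] /= zx; apply/seteqP; split=> y /= h.
  exact: connected_trans (connected_sym zx) h.
exact: connected_trans zx h.
Qed.

Lemma rho_le_sym (G : graph) n (x y : G) : rho_le n x y -> rho_le n y x.
Proof. by move=> /rho_leP[m mn /walk_sym w]; apply/rho_leP; exists m. Qed.

Lemma rho_le_refl (G : graph) n (x : G) : rho_le n x x.
Proof. by apply/rho_leP; exists 0. Qed.

Lemma finite_walk (G : graph) n (x : G) :
  locally_finite G -> finite_set [set y | walk n x y].
Proof.
move=> lf; elim: n x => [|n IH] x /=.
  by rewrite (_ : [set y | x = y] = [set x])//; apply/seteqP; split=> y /=.
rewrite (_ : [set _ | _] = \bigcup_(z in [set z | adj x z]) [set y | walk n z y]).
  by apply: bigcup_finite => [|z _]; [exact: lf|exact: IH].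
by apply/seteqP; split=> y /= [z]; [case=> xz zy; exists z|exists z].
Qed.

Lemma finite_ball (G : graph) n (x : G) :
  locally_finite G -> finite_set [set y | rho_le n x y].
Proof.
move=> lf.
apply: (@sub_finite_set _ _ (\bigcup_(m in `I_n.+1) [set y | walk m x y])).
  by move=> y /rho_leP[m mn w]; exists m.
by apply: bigcup_finite => // m _; exact: finite_walk.
Qed.

Section Power.
Variables (G : graph) (r : nat).
Let padj (x y : G) := x <> y /\ rho_le r x y.
Fact power_sym x y : padj x y -> padj y x.
Proof. by move=> [xy h]; split=> [e|]; [exact: xy|exact: rho_le_sym]. Qed.
Fact power_irr x : ~ padj x x. Proof. by case. Qed.
Definition power : graph := Graph power_sym power_irr.
End Power.

(** * Coloring problems *)

Record coloring_problem := ColoringProblem {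
  Gamma : graph -> Prop;
  Pi : forall G : graph, (G -> HF) -> Prop;
  Gamma_locally_finite : forall G, Gamma G -> locally_finite G;
  Gamma_iso : forall (G H : graph) (phi : G -> H),
    graph_iso phi -> Gamma G -> Gamma H;
  Gamma_component : forall G, locally_finite G ->
    Gamma G <-> forall C : set G, is_component C -> Gamma (induced C);
  (* the pushforward of c \o phi along phi is c *)
  Pi_iso : forall (G H : graph) (phi : G -> H) (c : H -> HF),
    graph_iso phi -> Gamma G -> Pi (c \o phi) -> Pi c;
  Pi_component : forall (G : graph) (c : G -> HF), Gamma G ->
    Pi c <-> forall C : set G, is_component C ->
      Pi (fun x : induced C => c (val x)) }.

Definition proper (G : graph) (T : Type) (c : G -> T) : Prop :=
  forall x y, adj x y -> c x <> c y.

Definition colorable (k : nat) (G : graph) : Prop :=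
  exists c : G -> 'I_k, proper c.

(* The palette of q colors is the von Neumann numeral q = {0, ..., q - 1}. *)
Definition proper_coloring (q : nat) (G : graph) (c : G -> HF) : Prop :=
  (forall x, hf_mem (c x) (hf_nat q)) /\ proper c.

Definition lf_colorable (k : nat) (G : graph) : Prop :=
  locally_finite G /\ colorable k G.

Lemma locally_finite_induced (G : graph) (W : set G) :
  locally_finite G -> locally_finite (induced W).
Proof.
move=> lf x; apply: (@finite_preimage _ _ [set y | adj (val x) y] val).
  by move=> a b _ _; exact: val_inj.
exact: lf.
Qed.

Lemma lf_colorable_iso k (G H : graph) (phi : G -> H) :
  graph_iso phi -> lf_colorable k G -> lf_colorable k H.
Proof.
move=> [[psi pK Kp] hphi] [lf [c pc]]; split.
  move=> y; rewrite (_ : [set _ | _] = phi @` [set z | adj (psi y) z]).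
    exact/finite_image/lf.
  apply/seteqP; split=> [z /= yz|_ [z /= yz <-]]; last by rewrite -[y]Kp -hphi.
  by exists (psi z); rewrite ?Kp// hphi !Kp.
by exists (c \o psi) => x y; rewrite -{1}[x]Kp -{1}[y]Kp -hphi; exact: pc.
Qed.

Lemma lf_colorable_component k (G : graph) : locally_finite G ->
  lf_colorable k G <->
  forall C : set G, is_component C -> lf_colorable k (induced C).
Proof.
move=> lf; split=> [[_ [c pc]] C _|H].
  split; first exact: locally_finite_induced.
  by exists (c \o val) => x y; exact: pc.
split=> //.
pose F C (hC : is_component C) := sval (cid (H C hC).2).
have FP C hC : proper (@F C hC) by rewrite /F; case: cid.
pose K (x : G) := [set y | connected x y].
have hK x : is_component (K x) by exists x.
have inK x : x \in K x by apply/mem_set; exact: connected_refl.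
exists (fun x => F (K x) (hK x) (exist _ x (inK x))) => x y xy.
have e : K x = K y.
  by apply: component_eq => //; exists 1; exists y.
move: (hK y) (inK y); rewrite -e => hK' inK'.
by rewrite (Prop_irrelevance hK' (hK x)); exact: FP.
Qed.

Lemma proper_coloring_iso q (G H : graph) (phi : G -> H) (c : H -> HF) :
  graph_iso phi -> proper_coloring q (c \o phi) -> proper_coloring q c.
Proof.
move=> [[psi pK Kp] hphi] [hq pc]; split=> [x|x y].
  by rewrite -[x]Kp; exact: hq.
by rewrite -[x]Kp -[y]Kp -hphi; exact: pc.
Qed.

Lemma proper_coloring_component q (G : graph) (c : G -> HF) :
  proper_coloring q c <-> forall C : set G, is_component C ->
    proper_coloring q (fun x : induced C => c (val x)).
Proof.
split=> [[hq pc] C _|H]; first by split=> [x|x y]; [exact: hq|exact: pc].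
have loc x y : connected x y -> exists C : set G,
    [/\ is_component C, C x & C y].
  by exists [set z | connected x z]; split=> //; [exists x|exact: connected_refl].
split=> [x|x y xy].
  have [C [hC /mem_set Cx _]] := loc x x (connected_refl x).
  by have [/(_ (exist _ x Cx))] := H C hC.
have [|C [hC /mem_set Cx /mem_set Cy]] := loc x y; first by exists 1; exists y.
by have [_ /(_ (exist _ x Cx) (exist _ y Cy))] := H C hC; exact.
Qed.

(* Proper q-coloring of locally finite k-colorable graphs. *)
Definition coloring (k q : nat) : coloring_problem :=
  @ColoringProblem (lf_colorable k) (@proper_coloring q)
    (fun _ h => h.1)
    (@lf_colorable_iso k)
    (@lf_colorable_component k)
    (fun _ _ _ _ i _ => proper_coloring_iso i)
    (fun _ _ _ => proper_coloring_component _ _).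

(** * ASI algorithms *)

Definition linear_order (T : Type) (lt : T -> T -> Prop) : Prop :=
  [/\ forall x, ~ lt x x, forall x y z, lt x y -> lt y z -> lt x z
    & forall x y, [\/ lt x y, x = y | lt y x]].

(* A partition into labelled, possibly empty, parts. *)
Definition is_partition (T : Type) (s : nat) (U : 'I_s.+1 -> set T) : Prop :=
  (forall x, exists i, U i x) /\ (forall i j x, U i x -> U j x -> i = j).

Record asi_input (s : nat) := ASIInput {
  ai_graph :> graph;
  ai_finite : finite_set [set: ai_graph];
  ai_lt : ai_graph -> ai_graph -> Prop;
  ai_linear : linear_order ai_lt;
  ai_part : 'I_s.+1 -> set ai_graph;
  ai_partP : is_partition ai_part;
  ai_set : set ai_graph }.
Arguments ai_set {s} _ _.

Definition asi_iso (s : nat) (I J : asi_input s) (phi : I -> J) : Prop :=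
  [/\ graph_iso phi,
      forall x y, ai_lt x y <-> ai_lt (phi x) (phi y),
      forall i x, ai_part i x <-> ai_part i (phi x)
    & forall x, ai_set I x <-> ai_set J (phi x)].

Record asi_algorithm (s : nat) := ASIAlgorithm {
  asi_fun :> forall I : asi_input s, ai_set I -> HF;
  asi_invariant : forall (I J : asi_input s) (phi : I -> J), asi_iso phi ->
    forall (x : ai_set I) (y : ai_set J),
      val y = phi (val x) -> asi_fun x = asi_fun y }.

(* For e : I -> HF injective, the copy of the input I with vertex set
   range e, as a hereditarily finite set. *)
Definition code_input (s : nat) (I : asi_input s) (e : I -> HF) : HF :=
  hf_tuple
    ([:: hf_pair (hf_of (range e))
           (hf_of [set hf_pair (e p.1) (e p.2) | p in [set p | adj p.1 p.2]]);
         hf_of [set hf_pair (e p.1) (e p.2) | p in [set p | ai_lt p.1 p.2]]]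
     ++ [seq hf_of (e @` ai_part i) | i <- enum 'I_s.+1]
     ++ [:: hf_of (e @` ai_set I)]).

Definition code_output (s : nat) (I : asi_input s) (e : I -> HF)
    (c : ai_set I -> HF) : HF :=
  hf_of (range (fun x => hf_pair (e (val x)) (c x))).

(* The inputs that are hereditarily finite are those whose vertices are; up to
   isomorphism these are the inputs with an injection e of the vertices in HF. *)
Definition computable (s : nat) (A : asi_algorithm s) : Prop :=
  exists f : recf 1, forall (I : asi_input s) (e : I -> HF), injective e ->
    reval f [tuple code_input e] (code_output e (@A I)).

(** * Running an ASI algorithm *)

Definition asi_witness (s r : nat) (G : graph) (U : 'I_s.+1 -> set G) : Prop :=
  is_partition U /\
  forall i (C : set (induced (U i : set (power G r)))),
    is_component C -> finite_set C.

Section Run.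
Variables (s r n : nat) (G : graph) (lt : G -> G -> Prop).
Variable U : 'I_s.+1 -> set G.
Hypotheses (lfG : locally_finite G) (ltP : linear_order lt).
Hypothesis UP : asi_witness r U.

Definition cells : set (set G) :=
  [set C | exists (i : 'I_s.+1) (D : set (induced (U i : set (power G r)))),
     is_component D /\ C = val @` D].

Let tadj (C D : cells) := C <> D /\
  exists x y, [/\ val C x, val D y & rho_le r x y].
Fact tilde_sym C D : tadj C D -> tadj D C.
Proof.
move=> [CD [x [y [Cx Dy xy]]]]; split=> [e|]; first exact: CD.
by exists y, x; split=> //; exact: rho_le_sym.
Qed.
Fact tilde_irr C : ~ tadj C C. Proof. by case. Qed.
Definition tilde : graph := Graph tilde_sym tilde_irr.

Definition window (C : tilde) : set G :=
  \bigcup_(D in [set D : tilde | rho_le n C D]) (val D : set G).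

Lemma cells_cover x : exists C : tilde, (val C : set G) x.
Proof.
have [i Uix] := UP.1.1 x; have xU := mem_set Uix.
pose x' : induced (U i : set (power G r)) := exist _ x xU.
pose D := [set y | connected x' y].
have hD : cells (val @` D) by exists i, D; split=> //; exists x'.
exists (exist (fun C => C \in cells) _ (mem_set hD)) => /=.
by exists x' => //; exact: connected_refl.
Qed.

Lemma cells_disjoint (C D : tilde) x :
  (val C : set G) x -> (val D : set G) x -> C = D.
Proof.
case: C => C hC; case: D => D hD /= Cx Dx; apply: val_inj => /=.
move: (set_mem hC) (set_mem hD) Cx Dx.
move=> [i [C' [cC ->]]] [j [D' [cD ->]]] [x1 Cx1 e1] [x2 Dx2 e2].
have ij : i = j.
  by apply: (UP.1.2 i j x); [rewrite -e1|rewrite -e2]; exact: set_valP.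
subst j; have e12 : x1 = x2 by apply: val_inj; rewrite e1 e2.
by subst x2; rewrite (component_eq cC Cx1) (component_eq cD Dx2).
Qed.

Lemma cells_finite (C : tilde) : finite_set (val C : set G).
Proof.
case: C => C hC /=; have [i [D [cD ->]]] := set_mem hC.
exact/finite_image/(UP.2 i).
Qed.

Lemma tilde_locally_finite : locally_finite tilde.
Proof.
move=> C; pose cell y := sval (cid (cells_cover y)).
have cellP y : (val (cell y) : set G) y by rewrite /cell; case: cid.
apply: (@sub_finite_set _ _
  (cell @` (\bigcup_(x in (val C : set G)) [set y | rho_le r x y]))).
  move=> D [_ [x [y [Cx Dy xy]]]]; exists y; first by exists x.
  exact: cells_disjoint (cellP y) Dy.
apply/finite_image/bigcup_finite => [|x _]; first exact: cells_finite.
exact: finite_ball.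
Qed.

Lemma window_finite C : finite_set (window C).
Proof.
apply: bigcup_finite => [|D _]; last exact: cells_finite.
exact/finite_ball/tilde_locally_finite.
Qed.

Lemma cell_sub_window (C : tilde) : (val C : set G) `<=` window C.
Proof. by move=> x Cx; exists C => //; exact: rho_le_refl. Qed.

Section Input.
Variable C : tilde.
Let W : set G := window C.

Fact window_input_finite : finite_set [set: induced W].
Proof.
apply: (@sub_finite_set _ _ (val @^-1` W)).
  by move=> x _; exact: set_valP.
by apply: finite_preimage; [move=> a b _ _; exact: val_inj|exact: window_finite].
Qed.

Fact window_linear : linear_order (fun x y : induced W => lt (val x) (val y)).
Proof.
case: ltP => irr tr tot; split=> [x|x y z|x y]; first exact: irr.
  exact: tr.
by case: (tot (val x) (val y)) => h;
  [constructor 1|constructor 2; exact: val_inj|constructor 3].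
Qed.

Fact window_partition :
  is_partition (fun i => [set x : induced W | U i (val x)]).
Proof.
by split=> [x|i j x]; [exact: UP.1.1|exact: UP.1.2].
Qed.

Definition window_input : asi_input s :=
  ASIInput window_input_finite window_linear window_partition
    [set x | (val C : set G) (val x)].

Definition window_point (x : G) (Cx : (val C : set G) x) : ai_set window_input :=
  exist (fun y => y \in ai_set window_input)
    (exist (fun y => y \in W) x (mem_set (cell_sub_window Cx))) (mem_set Cx).

End Input.

(* The color of x is given by the unique cell containing x. *)
Definition asi_run (A : asi_algorithm s) (x : G) : HF :=
  let: exist C Cx := cid (cells_cover x) in A (window_input C) (window_point Cx).

Lemma asi_runE (A : asi_algorithm s) (C : tilde) (x : G)
    (Cx : (val C : set G) x) :
  asi_run A x = A (window_input C) (window_point Cx).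
Proof.
rewrite /asi_run; case: cid => D Dx.
have e := cells_disjoint Dx Cx; subst D.
by rewrite (Prop_irrelevance Dx Cx).
Qed.

End Run.

Definition ASI_c (s : nat) (P : coloring_problem) : Prop :=
  exists (A : asi_algorithm s) (n r : nat), computable A /\
    forall (G : graph) (hG : Gamma P G) (lt : G -> G -> Prop)
      (hlt : linear_order lt) (U : 'I_s.+1 -> set G) (hU : asi_witness r U),
      Pi P (asi_run n (Gamma_locally_finite hG) hlt hU A).

(* Main.v *)
Require Import Defs.
From mathcomp Require Import all_boot zify.
From mathcomp Require Import boolp classical_sets cardinality.

(** For each part [U_j], let [c_j] be the lexicographically least (for the given
    order) proper [k]-coloring of the subgraph induced on the closed neighborhood
    [N(U_j)].  At scale 3 the neighborhoods of distinct cells of [U_j] are joined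
    by no edge, so the restriction of [c_j] to the neighborhood of a cell only
    depends on that neighborhood, not on the window.

    For a vertex [y], let [j] be least such that [y] is in [U_j] or has a neighbor
    [x] in [U_j] with [c_j x = 0], and color [y] by [c_j y] in the [j]-th palette,
    where the [s + 1] palettes of [k] colors share the color 0.  Adjacent vertices
    with the same [j] both lie in [N(U_j)], so they get distinct colors.  If two
    adjacent vertices [x], [y] both get the color 0, then properness of [c_j] puts
    each of them in its own part, and each one witnesses that the index of the
    other is at most its own; so the indices agree, which is the previous case.

    On codes, the algorithm is primitive recursive: a map from vertices to
    [0, ..., k] is coded by the digits of a number in base [k + 1]. *)

Set Implicit Arguments.
Unset Strict Implicit.
Unset Printing Implicit Defensive.

Local Open Scope classical_set_scope.

(** * Recursive functions *)

(** Functions on lists rather than tuples can be written with [head] and [behead] and composed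
    without length proofs; only lists of length [n] are constrained. *)
Definition recfun (n : nat) (F : seq nat -> nat) : Prop :=
  exists f : recf n, forall v : n.-tuple nat, reval f v (F v).

Notation recpred n P := (recfun n (fun v => nat_of_bool (P v))).

Lemma eq_recfun n F G : (forall v, size v = n -> F v = G v) ->
  recfun n F -> recfun n G.
Proof. by move=> FG [f hf]; exists f => v; rewrite -FG ?size_tuple. Qed.

Lemma recfun_comp m n F (gs : seq (seq nat -> nat)) : size gs = m ->
  recfun m F -> (forall i, i < m -> recfun n (nth (fun=> 0) gs i)) ->
  recfun n (fun v => F [seq g v | g <- gs]).
Proof.
move=> sz [f hf] hg.
have [g gP] := choice (fun i : 'I_m => hg i (ltn_ord i)).
exists (rcomp f g) => v /=.
have szv : size [seq g0 (tval v) | g0 <- gs] == m by rewrite size_map sz.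
exists (Tuple szv); last exact: hf.
move=> i; rewrite (tnth_nth 0) /= (nth_map (fun=> 0)) ?sz //; exact: gP.
Qed.

Lemma recfun_nth n i : i < n -> recfun n (fun v => nth 0 v i).
Proof.
by move=> lt_in; exists (rproj (Ordinal lt_in)) => v /=; rewrite (tnth_nth 0).
Qed.

(* Unfolds to nested [behead]s, the form in which a variable appears under the
   binders of [recfun_iteri] and [recpred_all]. *)
Definition var i (v : seq nat) := head 0 (iter i behead v).

Lemma varE i v : var i v = nth 0 v i.
Proof.
rewrite /var; elim: i v => [|i IH] v; first by case: v.
by rewrite iterSr IH nth_behead.
Qed.

Lemma recfun_var n i : i < n -> recfun n (var i).
Proof.
by move=> h; apply: (eq_recfun _ (recfun_nth h)) => v _; rewrite varE.
Qed.

Lemma recfun_const n m : recfun n (fun=> m).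
Proof.
elim: m => [|m [f hf]]; first by exists (rzero n).
exists (rcomp rsucc (fun=> f)) => v /=.
by exists [tuple m] => // i; rewrite (ord1 i) (tnth_nth 0) /=; exact: hf.
Qed.

(** Primitive recursion on the number of steps: [H] takes this number as an extra first argument,
    for which [recfun_comp] then substitutes [B v], with projections for the other arguments. *)
Lemma recfun_iteri n (B F : seq nat -> nat) (G : nat -> nat -> seq nat -> nat) :
  recfun n B -> recfun n F ->
  recfun n.+2 (fun w => G (head 0 w) (head 0 (behead w)) (behead (behead w))) ->
  recfun n (fun v => iteri (B v) (fun j a => G j a v) (F v)).
Proof.
move=> hB [f hf] [g hg].
pose H w := iteri (head 0 w) (fun j a => G j a (behead w)) (F (behead w)).
have hH : recfun n.+1 H.
  exists (rprec f g) => v /=.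
  exists (fun j => iteri j (fun j a => G j a (behead v)) (F (behead v))).
  split=> /= [|j _|]; first exact: hf.
    exact: (hg [tuple of j :: _ :: behead v]).
  by rewrite /H (_ : head 0 v = thead v)//; case/tupleP: v => x v; rewrite theadE.
pose gs := B :: [seq (fun v : seq nat => nth 0 v i) | i <- iota 0 n].
apply: (eq_recfun _ (@recfun_comp _ n _ gs _ hH _)) => [v szv||[|i]] //=.
- rewrite /H /= -map_comp (_ : map _ _ = v)//.
  by rewrite -[RHS](mkseq_nth 0) szv.
- by rewrite size_map size_iota.
- rewrite ltnS => lt_in; rewrite (nth_map 0) ?size_iota// nth_iota//.
  exact: recfun_nth.
Qed.

(** The step function in [recfun_iteri] sees the counter, the accumulator and the parameters; this
    serves bodies that do not read the accumulator. *)
Lemma recfun_skip n (Q : nat -> seq nat -> nat) :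
  recfun n.+1 (fun w => Q (head 0 w) (behead w)) ->
  recfun n.+2 (fun w => Q (head 0 w) (behead (behead w))).
Proof.
move=> hQ; pose gs := var 0 :: [seq (fun v => nth 0 v i) | i <- iota 2 n].
apply: (eq_recfun _ (@recfun_comp _ n.+2 _ gs _ hQ _)) => [[|x [|y v]]//= szv||[|i]] //=.
- rewrite -map_comp (_ : map _ _ = v)// -[RHS](mkseq_nth 0).
  by rewrite (iotaDl 2 0) -map_comp; case: szv => ->.
- by rewrite size_map size_iota.
- by move=> _; exact: recfun_var.
- rewrite ltnS => lt_in; rewrite (nth_map 0) ?size_iota// nth_iota//.
  by apply: recfun_nth; rewrite !ltnS.
Qed.

Lemma recfun1 n (f : nat -> nat) s : recfun 1 (fun v => f (head 0 v)) ->
  recfun n s -> recfun n (fun v => f (s v)).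
Proof.
by move=> hf hs; apply: (@recfun_comp _ n _ [:: s] erefl hf) => -[].
Qed.

Lemma recfun2 n (f : nat -> nat -> nat) s t :
  recfun 2 (fun v => f (head 0 v) (head 0 (behead v))) ->
  recfun n s -> recfun n t -> recfun n (fun v => f (s v) (t v)).
Proof.
by move=> hf hs ht; apply: (@recfun_comp _ n _ [:: s; t] erefl hf) => -[|[]].
Qed.

Lemma recfun3 n (f : nat -> nat -> nat -> nat) s t u :
  recfun 3 (fun v => f (head 0 v) (head 0 (behead v)) (head 0 (behead (behead v)))) ->
  recfun n s -> recfun n t -> recfun n u -> recfun n (fun v => f (s v) (t v) (u v)).
Proof.
by move=> hf hs ht hu; apply: (@recfun_comp _ n _ [:: s; t; u] erefl hf) => -[|[|[]]].
Qed.

Ltac rvar := first [exact: (@recfun_var _ 0) | exact: (@recfun_var _ 1)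
  | exact: (@recfun_var _ 2) | exact: (@recfun_var _ 3)
  | exact: (@recfun_var _ 4) | exact: (@recfun_var _ 5) | exact: (@recfun_var _ 6)].

(** * Arithmetic, Boolean operations, bounded sums and bounded searches *)

Lemma recfun_succ n s : recfun n s -> recfun n (fun v => (s v).+1).
Proof.
apply: (@recfun1 _ succn); exists rsucc => v /=.
by case/tupleP: v => x v; rewrite theadE.
Qed.

Lemma recfun_add n s t : recfun n s -> recfun n t -> recfun n (fun v => s v + t v).
Proof.
apply: (@recfun2 _ addn).
apply: (@eq_recfun _ (fun v => iteri (head 0 (behead v)) (fun _ a => a.+1) (head 0 v))).
  by move=> v _; elim: (head 0 (behead v)) => [|m IH] /=; rewrite ?addn0// IH addnS.
apply: recfun_iteri; [rvar|rvar|apply: recfun_succ; rvar].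
Qed.

Lemma recfun_mul n s t : recfun n s -> recfun n t -> recfun n (fun v => s v * t v).
Proof.
apply: (@recfun2 _ muln).
apply: (@eq_recfun _
  (fun v => iteri (head 0 (behead v)) (fun _ a => head 0 v + a) 0)).
  by move=> v _; elim: (head 0 (behead v)) => [|m IH] /=; rewrite ?muln0// IH mulnS.
apply: recfun_iteri; [rvar|exact: recfun_const|apply: recfun_add; rvar].
Qed.

Lemma recfun_exp n s t : recfun n s -> recfun n t -> recfun n (fun v => s v ^ t v).
Proof.
apply: (@recfun2 _ expn).
apply: (@eq_recfun _
  (fun v => iteri (head 0 (behead v)) (fun _ a => head 0 v * a) 1)).
  by move=> v _; elim: (head 0 (behead v)) => [|m IH] //=; rewrite IH expnS.
apply: recfun_iteri; [rvar|exact: recfun_const|apply: recfun_mul; rvar].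
Qed.

Lemma recfun_pred n s : recfun n s -> recfun n (fun v => (s v).-1).
Proof.
apply: (@recfun1 _ predn).
apply: (@eq_recfun _ (fun v => iteri (head 0 v) (fun j _ => j) 0)).
  by move=> v _; case: (head 0 v).
apply: recfun_iteri; [rvar|exact: recfun_const|rvar].
Qed.

Lemma recfun_sub n s t : recfun n s -> recfun n t -> recfun n (fun v => s v - t v).
Proof.
apply: (@recfun2 _ subn).
apply: (@eq_recfun _ (fun v => iteri (head 0 (behead v)) (fun _ a => a.-1) (head 0 v))).
  by move=> v _; elim: (head 0 (behead v)) => [|m IH] /=; rewrite ?subn0// IH subnS.
apply: recfun_iteri; [rvar|rvar|apply: recfun_pred; rvar].
Qed.

Lemma recpred_not n p : recpred n p -> recpred n (fun v => ~~ p v).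
Proof.
move=> hp; apply: (@eq_recfun _ (fun v => 1 - p v)) => [v _|]; first by case: (p v).
by apply: recfun_sub => //; exact: recfun_const.
Qed.

Lemma recpred_and n p q : recpred n p -> recpred n q ->
  recpred n (fun v => p v && q v).
Proof.
move=> hp hq; apply: (@eq_recfun _ (fun v => p v * q v)) => [v _|].
  by rewrite mulnb.
exact: recfun_mul.
Qed.

Lemma recpred_or n p q : recpred n p -> recpred n q ->
  recpred n (fun v => p v || q v).
Proof.
move=> hp hq.
apply: (@eq_recfun _ (fun v => ~~ (~~ p v && ~~ q v))) => [v _|].
  by rewrite negb_and !negbK.
by apply/recpred_not/recpred_and; exact: recpred_not.
Qed.

Lemma recpred_imply n p q : recpred n p -> recpred n q ->
  recpred n (fun v => p v ==> q v).
Proof.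
move=> hp hq; apply: (@eq_recfun _ (fun v => ~~ p v || q v)) => [v _|].
  by rewrite implybE.
by apply: recpred_or => //; exact: recpred_not.
Qed.

Lemma recpred_leq n s t : recfun n s -> recfun n t ->
  recpred n (fun v => s v <= t v).
Proof.
move=> hs ht; apply: (@eq_recfun _ (fun v => 1 - (s v - t v))) => [v _|].
  by rewrite /leq; case: (s v - t v).
by apply: recfun_sub; [exact: recfun_const|exact: recfun_sub].
Qed.

Lemma recpred_eq n s t : recfun n s -> recfun n t ->
  recpred n (fun v => s v == t v).
Proof.
move=> hs ht; apply: (@eq_recfun _ (fun v => (s v <= t v) && (t v <= s v))) => [v _|].
  by rewrite eqn_leq.
by apply: recpred_and; exact: recpred_leq.
Qed.

Lemma recfun_if n p s t : recpred n p -> recfun n s -> recfun n t ->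
  recfun n (fun v => if p v then s v else t v).
Proof.
move=> hp hs ht.
apply: (@eq_recfun _ (fun v => p v * s v + ~~ p v * t v)) => [v _|].
  by case: (p v); rewrite ?mul1n ?addn0.
by apply: recfun_add; apply: recfun_mul => //; exact: recpred_not.
Qed.

Lemma recfun_sum n (Q : nat -> seq nat -> nat) B : recfun n B ->
  recfun n.+1 (fun w => Q (head 0 w) (behead w)) ->
  recfun n (fun v => \sum_(y <- iota 0 (B v)) Q y v).
Proof.
move=> hB hQ; apply: (@eq_recfun _ (fun v => iteri (B v) (fun j a => a + Q j v) 0)).
  move=> v _; elim: (B v) => [|m IH]; first by rewrite big_nil.
  by rewrite -addn1 iotaD big_cat big_seq1 addn1 /= IH.
apply: recfun_iteri => //; first exact: recfun_const.
by apply: recfun_add; [rvar|exact: recfun_skip].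
Qed.

Lemma recpred_all n (Q : nat -> seq nat -> bool) B : recfun n B ->
  recpred n.+1 (fun w => Q (head 0 w) (behead w)) ->
  recpred n (fun v => all (fun y => Q y v) (iota 0 (B v))).
Proof.
move=> hB hQ; apply: (@eq_recfun _ (fun v => iteri (B v) (fun j a => a * Q j v) 1)).
  move=> v _; elim: (B v) => [|m IH] //.
  by rewrite -addn1 iotaD all_cat all_seq1 addn1 /= IH mulnb.
apply: recfun_iteri => //; first exact: recfun_const.
by apply: recfun_mul; [rvar|exact: (@recfun_skip _ (fun j v => Q j v))].
Qed.

Lemma recpred_has n (Q : nat -> seq nat -> bool) B : recfun n B ->
  recpred n.+1 (fun w => Q (head 0 w) (behead w)) ->
  recpred n (fun v => has (fun y => Q y v) (iota 0 (B v))).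
Proof.
move=> hB hQ.
apply: (@eq_recfun _ (fun v => ~~ all (fun y => ~~ Q y v) (iota 0 (B v)))) => [v _|].
  by rewrite -has_predC; congr nat_of_bool; apply: eq_has => y /=; rewrite negbK.
apply/recpred_not/(@recpred_all _ (fun y v => ~~ Q y v)) => //; exact: recpred_not.
Qed.

Lemma recfun_find n (Q : nat -> seq nat -> bool) B : recfun n B ->
  recpred n.+1 (fun w => Q (head 0 w) (behead w)) ->
  recfun n (fun v => find (fun y => Q y v) (iota 0 (B v))).
Proof.
move=> hB hQ.
(* The accumulator equals [j] as long as no index below [j] has succeeded; it stops growing at the
   first success. *)
apply: (@eq_recfun _
  (fun v => iteri (B v) (fun j a => a + ((a == j) && ~~ Q j v)) 0)).
  move=> v _; elim: (B v) => [|m IH] //.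
  rewrite -[in RHS]addn1 iotaD find_cat size_iota /= IH.
  have := has_find (Q^~ v) (iota 0 m); rewrite size_iota.
  case: ifP => h; first by move/esym => /ltn_eqF ->; rewrite addn0.
  move: h => /negbT/hasNfind; rewrite size_iota => ->; rewrite eqxx /=.
  by case: (Q m v).
apply: recfun_iteri => //; first exact: recfun_const.
apply: recfun_add; first rvar.
apply: recpred_and; first by apply: recpred_eq; rvar.
by apply: recpred_not; exact: (@recfun_skip _ (fun j v => Q j v)).
Qed.

Lemma recfun_iter n (f : nat -> nat) s t : recfun 1 (fun v => f (head 0 v)) ->
  recfun n s -> recfun n t -> recfun n (fun v => iter (s v) f (t v)).
Proof.
move=> hf; apply: (@recfun2 _ (fun a b => iter a f b)).
apply: (@eq_recfun _ (fun v => iteri (head 0 v) (fun _ => f) (head 0 (behead v)))).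
  by move=> v _; elim: (head 0 v) => //= m ->.
by apply: recfun_iteri; [rvar|rvar|apply: recfun1 => //; rvar].
Qed.

Lemma recpred_odd n s : recfun n s -> recpred n (fun v => odd (s v)).
Proof.
move=> hs; apply: (@eq_recfun _ (fun v => iter (s v) (subn 1) 0)).
  by move=> v _; elim: (s v) => //= m ->; case: (odd m).
apply: recfun_iter => //; last exact: recfun_const.
by apply: recfun_sub; [exact: recfun_const|rvar].
Qed.

(** The quotient of a by b is the least y with a < (y + 1) b, searched among y < a. When the
    quotient is a itself, the search fails and [find] returns the length a, which is the right
    value. *)
Lemma recfun_div n s t : (forall v, 0 < t v) -> recfun n s -> recfun n t ->
  recfun n (fun v => s v %/ t v).
Proof.
move=> t0 hs ht.
suff h : recfun 2 (fun v => find (fun y => head 0 v < y.+1 * head 0 (behead v))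
    (iota 0 (head 0 v))).
  have := @recfun2 n (fun a b => find (fun y => a < y.+1 * b) (iota 0 a)) _ _ h hs ht.
  apply: eq_recfun => v _; set a := s v; set b := t v; have b0 : 0 < b := t0 v.
  have ge m : (a < m.+1 * b) = (a %/ b <= m) by rewrite -ltn_divLR.
  rewrite (eq_find (a2 := fun y => a %/ b <= y)) => [|y]; last exact: ge.
  have le : a %/ b <= a by exact: leq_div.
  rewrite -[X in iota _ X](subnKC le) iotaD find_cat add0n.
  case: hasP => [[y]|_]; first by rewrite mem_iota /= add0n ltnNge => /negbTE->.
  by rewrite size_iota; case: (a - _) => [|m] /=; rewrite ?addn0 ?leqnn ?addn0.
apply: recfun_find; first rvar.
by apply: recpred_leq; [apply: recfun_succ|apply: recfun_mul; [apply: recfun_succ|]]; rvar.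
Qed.

Lemma recfun_mod n s t : (forall v, 0 < t v) -> recfun n s -> recfun n t ->
  recfun n (fun v => s v %% t v).
Proof.
move=> t0 hs ht.
apply: (@eq_recfun _ (fun v => s v - s v %/ t v * t v)).
  by move=> v _; rewrite {1}(divn_eq (s v) (t v)) addKn.
by apply: recfun_sub => //; apply: recfun_mul => //; exact: recfun_div.
Qed.

(** * Operations on hereditarily finite sets *)

Lemma recpred_hf_mem n s t : recfun n s -> recfun n t ->
  recpred n (fun v => hf_mem (s v) (t v)).
Proof.
move=> hs ht; apply/recpred_odd/recfun_div => [v|//|]; first by rewrite expn_gt0.
by apply: recfun_exp => //; exact: recfun_const.
Qed.

(** Replaces [hf_of] by a sum of powers of 2 over an explicit list, which recursive functions can
    evaluate. *)
Lemma hf_of_seq (S : set HF) (l : seq nat) : uniq l -> (forall x, S x <-> x \in l) ->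
  hf_of S = \sum_(y <- l) 2 ^ y.
Proof.
move=> ul Sl; apply: hf_ext => z; apply/idP/idP; rewrite hf_mem_sum//.
  by rewrite hf_mem_of ?Sl//; apply/finite_seqP; exists l; apply/seteqP; split=> x /Sl.
by move=> zl; rewrite hf_mem_of ?Sl//; apply/finite_seqP; exists l; apply/seteqP; split=> x /Sl.
Qed.

Lemma hf_of1 a : hf_of [set a] = 2 ^ a.
Proof.
by rewrite (@hf_of_seq _ [:: a]) ?big_seq1// => x; rewrite mem_seq1; split=> /= /eqP.
Qed.

Lemma hf_of2 a b : hf_of [set a; b] = if a == b then 2 ^ a else 2 ^ a + 2 ^ b.
Proof.
have [->|ab] := eqVneq; first by rewrite setUid hf_of1.
rewrite (@hf_of_seq _ [:: a; b]) ?big_cons ?big_nil ?addn0 /= ?mem_seq1 ?ab// => x.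
by rewrite !inE; split=> [[]->|/orP[]/eqP->]; rewrite ?eqxx ?orbT//; [left|right].
Qed.

Lemma recfun_hf_pair n s t : recfun n s -> recfun n t ->
  recfun n (fun v => hf_pair (s v) (t v)).
Proof.
have set2 m s' t' : recfun m s' -> recfun m t' ->
    recfun m (fun v => hf_of [set s' v; t' v]).
  move=> hs ht; apply: (eq_recfun (fun v _ => esym (hf_of2 (s' v) (t' v)))).
  have h2 u : recfun m u -> recfun m (fun v => 2 ^ u v).
    by apply: recfun_exp; exact: recfun_const.
  by apply: recfun_if; [exact: recpred_eq|exact: h2|apply: recfun_add; exact: h2].
move=> hs ht; apply: (set2); last exact: set2.
apply: (@eq_recfun _ (fun v => 2 ^ s v)) => [v _|]; first by rewrite hf_of1.
by apply: recfun_exp => //; exact: recfun_const.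
Qed.

Lemma hf_pair_inj a b c d : hf_pair a b = hf_pair c d -> a = c /\ b = d.
Proof.
have mem1 x y : hf_mem x (hf_of [set y]) <-> x = y by rewrite hf_mem_of.
have mem2 x y z : hf_mem x (hf_of [set y; z]) <-> x = y \/ x = z.
  by rewrite hf_mem_of.
have inj1 x y : hf_of [set x] = hf_of [set y] -> x = y.
  by move=> e; apply/mem1; rewrite -e; apply/mem1.
have inj12 x y z : hf_of [set x] = hf_of [set y; z] -> x = y /\ x = z.
  by move=> e; split; apply/esym/mem1; rewrite e; apply/mem2; [left|right].
rewrite /hf_pair => e.
have ac : a = c.
  have /mem2[/inj1//|/inj12[]//] : hf_mem (hf_of [set a])
    (hf_of [set hf_of [set c]; hf_of [set c; d]]).
  by rewrite -e; apply/mem2; left.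
subst c; split=> //.
(* Used in both directions: unless [b] and [d] agree outright, both are equal to [a]. *)
have sub x y : hf_pair a x = hf_pair a y -> x = a \/ x = y.
  move=> exy; have : hf_mem (hf_of [set a; x]) (hf_pair a y).
    by rewrite -exy; apply/mem2; right.
  by move=> /mem2[/esym/inj12[_ <-]|exy']; [left|apply/mem2; rewrite -exy'; apply/mem2; right].
by case: (sub _ _ e) (sub _ _ (esym e)) => -> // [].
Qed.

(** Each component belongs to a member of the pair, and membership lowers the Ackermann code. This
    bounds the searches in [hf_fst] and [hf_snd]. *)
Lemma hf_pair_gt a b : a < hf_pair a b /\ b < hf_pair a b.
Proof.
have h x : [set a; b] x -> x < hf_pair a b.
  move=> hx; apply: (@ltn_trans (hf_of [set a; b])); apply: hf_mem_lt.
    by rewrite hf_mem_of.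
  by rewrite hf_mem_of//; right.
by split; apply: h; [left|right].
Qed.

(** The projections are bounded searches, hence recursive. On a number that is not a pair they
    return the number itself. *)
Definition hf_fst p :=
  find (fun a => has (fun b => p == hf_pair a b) (iota 0 p)) (iota 0 p).

Definition hf_snd p :=
  find (fun b => has (fun a => p == hf_pair a b) (iota 0 p)) (iota 0 p).

Lemma find_iota_unique (p : pred nat) m n : m < n -> p m ->
  (forall i, p i -> i = m) -> find p (iota 0 n) = m.
Proof.
move=> mn pm uniq_m.
have hp : has p (iota 0 n) by apply/hasP; exists m; rewrite ?mem_iota.
have := nth_find 0 hp; rewrite nth_iota; first exact: uniq_m.
by rewrite -[X in _ < X](size_iota 0 n) -has_find.
Qed.

Lemma hf_fst_pair a b : hf_fst (hf_pair a b) = a.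
Proof.
have [ga gb] := hf_pair_gt a b.
apply: find_iota_unique => // [|i /hasP[j _ /eqP/hf_pair_inj[]//]].
by apply/hasP; exists b; rewrite ?mem_iota.
Qed.

Lemma hf_snd_pair a b : hf_snd (hf_pair a b) = b.
Proof.
have [ga gb] := hf_pair_gt a b.
apply: find_iota_unique => // [|i /hasP[j _ /eqP/hf_pair_inj[]//]].
by apply/hasP; exists a; rewrite ?mem_iota.
Qed.

Lemma recfun_hf_fst n s : recfun n s -> recfun n (fun v => hf_fst (s v)).
Proof.
apply: (@recfun1 _ hf_fst); apply: recfun_find; first rvar.
apply: recpred_has; first rvar.
by apply: recpred_eq; [rvar|apply: recfun_hf_pair; rvar].
Qed.

Lemma recfun_hf_snd n s : recfun n s -> recfun n (fun v => hf_snd (s v)).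
Proof.
apply: (@recfun1 _ hf_snd); apply: recfun_find; first rvar.
apply: recpred_has; first rvar.
by apply: recpred_eq; [rvar|apply: recfun_hf_pair; rvar].
Qed.

(** The von Neumann successor sets the bit at position [hf_nat m], which was not set because members
    have smaller codes. *)
Lemma hf_natS m : hf_nat m.+1 = hf_nat m + 2 ^ hf_nat m.
Proof.
pose x := hf_nat m; pose l := [seq i <- iota 0 x | hf_mem i x].
have ml i : (i \in l) = hf_mem i x.
  by rewrite mem_filter mem_iota add0n andb_idr//= => /hf_mem_lt.
have ul : uniq l by rewrite filter_uniq ?iota_uniq.
have xE : x = \sum_(y <- l) 2 ^ y by apply: hf_ext => z; rewrite hf_mem_sum ?ml.
have xl : x \notin l by rewrite ml; apply/negP => /hf_mem_lt; rewrite ltnn.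
rewrite /= (@hf_of_seq _ (x :: l)) ?big_cons /= ?xl//.
  by rewrite -xE addnC.
move=> z; rewrite inE ml /=; split=> [[->|->]|/orP[/eqP->|]]; rewrite ?eqxx ?orbT//.
  by right.
by left.
Qed.

Lemma recfun_hf_nat n s : recfun n s -> recfun n (fun v => hf_nat (s v)).
Proof.
move=> hs; apply: (@eq_recfun _ (fun v => iter (s v) (fun a => a + 2 ^ a) 0)).
  move=> v _; elim: (s v) => [|m IH]; last by rewrite hf_natS /= IH.
  by rewrite /= (@hf_of_seq _ [::]) ?big_nil.
apply: recfun_iter => //; last exact: recfun_const.
by apply: recfun_add; [|apply: recfun_exp; [exact: recfun_const|]]; rvar.
Qed.

(** * Finite maps coded by digits *)

Definition digit b d z := (d %/ b ^ z) %% b.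

Lemma recfun_digit n b s t : recfun n s -> recfun n t ->
  recfun n (fun v => digit b.+1 (s v) (t v)).
Proof.
move=> hs ht; apply: recfun_mod => //; last exact: recfun_const.
apply: recfun_div => [v||]; first by rewrite expn_gt0.
  by [].
by apply: recfun_exp => //; exact: recfun_const.
Qed.

(** Turns quantification over maps on an initial segment into a bounded search over numbers. By
    induction, the value at N is added as a new leading digit. *)
Lemma digits_surj b N (f : nat -> nat) : 0 < b -> (forall z, z < N -> f z < b) ->
  exists2 d, d < b ^ N & forall z, z < N -> digit b d z = f z.
Proof.
move=> b0; elim: N => [|N IH] fb; first by exists 0; rewrite ?expn_gt0 ?b0.
have [|d dN dP] := IH; first by move=> z zN; apply: fb; rewrite ltnS ltnW.
exists (d + f N * b ^ N).
  have : (f N).+1 * b ^ N <= b ^ N.+1 by rewrite expnS leq_mul2r fb ?orbT.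
  by apply: leq_trans; rewrite mulSn ltn_add2r.
move=> z; rewrite ltnS leq_eqVlt => /orP[/eqP->|zN]; rewrite /digit.
  by rewrite addnC divnMDl ?expn_gt0 ?b0// divn_small// addn0 modn_small ?fb.
(* For z < N the new summand is a multiple of b ^ z.+1, so the digit at z does not change. *)
have -> : b ^ N = b * b ^ (N - z).-1 * b ^ z.
  by rewrite -expnS prednK ?subn_gt0// -expnD subnK// ltnW.
rewrite mulnA addnC divnMDl ?expn_gt0 ?b0// mulnCA -modnDml modnMr.
exact: dP.
Qed.

(** * Lexicographically least colorings *)

(** Windows of one graph share [edge], [ord] and [part] and differ only in [dom], so their colorings
    are functions on the same type and can be glued. Abstract inputs and codes of inputs take the
    same form. *)
Record cstruct (T : Type) := CStruct {
  dom : T -> Prop;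
  edge : T -> T -> Prop;
  ord : T -> T -> Prop;
  part : nat -> T -> Prop }.

Section Lexicographic.
Variables (k : nat) (T : Type).
Implicit Types (S : cstruct T) (c d : T -> nat).

Definition nbhd S j u :=
  part S j u \/ exists x, [/\ dom S x, edge S x u & part S j x].

Definition good S j c :=
  (forall v, dom S v -> c v < k) /\
  (forall u v, dom S u -> dom S v -> edge S u v -> nbhd S j u -> nbhd S j v ->
    c u <> c v).

(** Over a finite linear order this says that at the first difference between [c] and a good [d],
    the value of [c] is the smaller one. *)
Definition lexmin S j c := good S j c /\
  forall d, good S j d -> forall v, dom S v -> d v < c v ->
    exists u, [/\ dom S u, ord S u v & d u <> c u].

(** An algorithm must also answer on graphs without a proper [k]-coloring. The default 0 is
    reproduced on codes by [lexcode]. *)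
Definition lexcol S j : T -> nat :=
  if pselect (exists c, lexmin S j c) is left h then sval (cid h) else fun=> 0.

(** A code orders only its own vertices, so its order is not linear on [nat]. This consequence of
    finiteness and linearity speaks of [dom] alone and transports along isomorphisms. *)
Definition ord_min S := forall P : T -> Prop, (exists2 v, dom S v & P v) ->
  exists v, [/\ dom S v, P v & forall u, dom S u -> P u -> ~ ord S u v].

Lemma lexcolP S j : (exists c, lexmin S j c) -> lexmin S j (lexcol S j).
Proof. by move=> h; rewrite /lexcol; case: pselect => // h'; case: cid. Qed.

End Lexicographic.

(** * Comparison of least colorings on two windows *)

Section Gluing.
Variables (k : nat) (T : Type) (E L : T -> T -> Prop) (U : nat -> T -> Prop).
Hypothesis Esym : forall x y, E x y -> E y x.
Implicit Types V X : T -> Prop.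
Let S V := CStruct V E L U.

(** Paste [c] on [X] into [c'] elsewhere. No relevant edge leaves [X], so the result [d] is good on
    [V']; minimality of [c'] against [d] yields a difference before [v], and differences occur only
    in [X]. *)
Lemma lexmin_glue V V' X j c c' : (forall x, X x -> V x) -> (forall x, X x -> V' x) ->
  (forall u, X u -> nbhd (S V') j u -> nbhd (S V) j u) ->
  (forall u v, X u -> V' v -> E u v -> nbhd (S V') j u -> nbhd (S V') j v -> X v) ->
  good k (S V) j c -> lexmin k (S V') j c' ->
  forall v, X v -> c v < c' v -> exists u, [/\ X u, L u v & c u <> c' u].
Proof.
move=> XV XV' XN closed [ck cE] [[c'k c'E] c'min] v Xv lt_v.
pose d x := if `[< X x >] then c x else c' x.
have dX x : X x -> d x = c x by move=> Xx; rewrite /d asboolT.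
have dN x : ~ X x -> d x = c' x by move=> Xx; rewrite /d asboolF.
have gd : good k (S V') j d.
  split=> [x V'x|x y V'x V'y Exy Nx Ny].
    by have [Xx|Xx] := pselect (X x); [rewrite dX//; exact/ck/XV|rewrite dN//; exact: c'k].
  have [Xx|Xx] := pselect (X x).
    have Xy : X y by exact: (closed x).
    by rewrite !dX//; apply: cE => //; [exact: XV|exact: XV|exact: XN|exact: XN].
  have Xy : ~ X y by move=> Xy; apply: Xx; apply: (closed y) => //; exact: Esym.
  by rewrite !dN//; exact: c'E.
have [|u [V'u Luv]] := c'min _ gd _ (XV' _ Xv); first by rewrite dX.
have [Xu|Xu] := pselect (X u); last by rewrite dN.
by rewrite dX// => ne; exists u.
Qed.

(** Take a first point of [X] where the colorings differ. Gluing the one that is smaller there into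
    the other produces an earlier difference in [X], a contradiction. *)
Lemma lexmin_agree V V' X j c c' : ord_min (S V) ->
  (forall x, X x -> V x) -> (forall x, X x -> V' x) ->
  (forall u, X u -> nbhd (S V) j u <-> nbhd (S V') j u) ->
  (forall u v, X u -> V v -> E u v -> nbhd (S V) j u -> nbhd (S V) j v -> X v) ->
  (forall u v, X u -> V' v -> E u v -> nbhd (S V') j u -> nbhd (S V') j v -> X v) ->
  lexmin k (S V) j c -> lexmin k (S V') j c' ->
  forall v, X v -> c v = c' v.
Proof.
move=> Vmin XV XV' XN cl cl' hc hc' v Xv; apply: contrapT => ne.
have [|w [Vw [Xw new] wmin]] := Vmin (fun x => X x /\ c x <> c' x).
  by exists v => //; exact: XV.
have no u : X u -> L u w -> c u <> c' u -> False.
  by move=> Xu Luw cu; apply: (wmin u) => //; exact: XV.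
case: (ltngtP (c w) (c' w)) => // lt_w.
  have [|u [Xu Luw cu]] := lexmin_glue XV XV' _ cl' hc.1 hc' Xw lt_w.
    by move=> u Xu /XN; exact.
  exact: no cu.
have [|u [Xu Luw cu]] := lexmin_glue XV' XV _ cl hc'.1 hc Xw lt_w.
  by move=> u Xu /XN; exact.
by apply: (no u) => // e; apply: cu.
Qed.

End Gluing.

Lemma lexmin_unique k T (S : cstruct T) j c c' : ord_min S ->
  (forall x y, edge S x y -> edge S y x) ->
  lexmin k S j c -> lexmin k S j c' -> forall v, dom S v -> c v = c' v.
Proof.
case: S => V E L U /= hmin Esym hc hc' v Vv.
by apply: (@lexmin_agree k T E L U Esym V V V j c c' hmin).
Qed.

(** * Existence of least colorings on finite structures *)

Section FiniteOrder.
Variables (T : eqType) (L : T -> T -> Prop).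
Hypothesis Llin : linear_order L.

Lemma seq_min (l : seq T) (P : T -> Prop) : (exists2 v, v \in l & P v) ->
  exists v, [/\ v \in l, P v & forall u, u \in l -> P u -> ~ L u v].
Proof.
have [irr tr _] := Llin.
elim: l => [|a l IH] [v]; first by [].
rewrite inE => vl Pv.
have [h|h] := pselect (exists2 v, v \in l & P v); last first.
  exists a; split; first by rewrite inE eqxx.
    by case/orP: vl => [/eqP<-//|vl]; case: h; exists v.
  move=> u; rewrite inE => /orP[/eqP->|ul] Pu; first exact: irr.
  by case: h; exists u.
have [m [ml Pm mmin]] := IH h.
have [[Pa Lam]|nLam] := pselect (P a /\ L a m).
  exists a; split; rewrite ?inE ?eqxx// => u; rewrite inE => /orP[/eqP->|ul] Pu.
    exact: irr.
  by move=> Lua; apply: (mmin u) => //; exact: tr Lam.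
exists m; split; rewrite ?inE ?ml ?orbT// => u; rewrite inE => /orP[/eqP->|ul] Pu.
  by move=> Lam; apply: nLam.
exact: mmin.
Qed.

(** Minimize the value at the head, then minimize along the tail among the functions attaining it. A
    competitor with another value at the head already differs there, before [v]. *)
Lemma seq_lexmin (l : seq T) (F : (T -> nat) -> Prop) :
  pairwise (fun x y => `[< L x y \/ x = y >]) l -> (exists c, F c) ->
  exists2 c, F c & forall d, F d -> forall v, v \in l -> d v < c v ->
    exists u, [/\ u \in l, L u v & d u <> c u].
Proof.
elim: l F => [|a l IH] F; first by move=> _ [c Fc]; exists c.
rewrite pairwise_cons => /andP[/allP al pl] [c0 Fc0].
have exa : exists m, `[< exists2 c, F c & c a = m >].
  by exists (c0 a); apply/asboolP; exists c0.
have [m /asboolP[c1 Fc1 c1a] mmin] := ex_minnP exa.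
have [|c [Fc ca] cmin] := IH (fun c => F c /\ c a = m) pl; first by exists c1.
exists c => // d Fd v vl lt_v.
have [da|da] := pselect (d a = m); last first.
  exists a; split; rewrite ?inE ?eqxx ?ca//.
  have nva : v <> a.
    move=> va; move: lt_v; rewrite va ca ltnNge mmin//.
    by apply/asboolP; exists d.
  move: vl; rewrite inE => /orP[/eqP//|/al/asboolP[//|]].
  by move=> e; case: nva.
move: vl; rewrite inE => /orP[/eqP va|vl]; first by move: lt_v; rewrite va ca da ltnn.
have [u [ul Luv du]] := cmin d (conj Fd da) v vl lt_v.
by exists u; split; rewrite ?inE ?ul ?orbT.
Qed.

End FiniteOrder.

Section FiniteStructure.
Variables (k : nat) (T : Type) (S : cstruct T).
Hypotheses (Sfin : finite_set (dom S : set T)) (Slin : linear_order (ord S)).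

Let dom_seq : exists l : seq {classic T}, forall v : T, dom S v <-> v \in l.
Proof.
have /finite_seqP[l e] : finite_set (dom S : set {classic T}) := Sfin.
by exists l => v; rewrite e.
Qed.

Lemma finite_ord_min : ord_min S.
Proof.
have [l lP] := dom_seq => P [v /lP vl Pv].
have [|w [wl Pw wmin]] := @seq_min {classic T} (ord S) Slin l P; first by exists v.
by exists w; split=> //; [exact/lP|move=> u /lP; exact: wmin].
Qed.

Lemma finite_lexmin j : (exists c, good k S j c) -> exists c, lexmin k S j c.
Proof.
have [l lP] := dom_seq; have [irr tr tot] := Slin => h.
pose leT (x y : {classic T}) := `[< ord S x y \/ x = y >].
have leT_total : total leT.
  move=> x y; case: (tot x y) => h'; apply/orP; [left|left|right]; apply/asboolP; tauto.
have leT_tr : transitive leT.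
  move=> y x z /asboolP[xy|->//] /asboolP[yz|<-//]; apply/asboolP; left=> //.
  - exact: tr yz.
have pl : pairwise leT (sort leT l).
  by rewrite -sorted_pairwise//; exact: sort_sorted.
have [c gc cmin] := @seq_lexmin {classic T} (ord S) (sort leT l) (good k S j) pl h.
exists c; split=> // d gd v /lP vl lt_v.
have [|u [ul Luv du]] := cmin d gd v _ lt_v; first by rewrite mem_sort.
by exists u; split=> //; apply/lP; rewrite mem_sort in ul.
Qed.

End FiniteStructure.

(** * Combining the colorings of the parts *)

Section Color.
Variables (k s : nat) (T : Type) (S : cstruct T).
Local Notation c_ := (lexcol k S).

Definition sel j y :=
  part S j y \/ exists x, [/\ dom S x, edge S x y, part S j x & c_ j x = 0].

Definition level y := find (fun j => `[< sel j y >]) (iota 0 s.+1).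

(* The color 0 is shared by the [s.+1] palettes; the others are
   [j * k.-1 + 1, ..., j * k.-1 + k.-1] for the palette [j]. *)
Definition col y :=
  if c_ (level y) y == 0 then 0 else level y * k.-1 + c_ (level y) y.

Lemma levelP y : (exists2 j, j <= s & part S j y) ->
  [/\ level y <= s, sel (level y) y & forall j, sel j y -> level y <= j].
Proof.
move=> [i le_is Uiy].
have hs : has (fun j => `[< sel j y >]) (iota 0 s.+1).
  by apply/hasP; exists i; rewrite ?mem_iota//; apply/asboolP; left.
have lt : level y < s.+1 by rewrite -[X in _ < X](size_iota 0 s.+1) -has_find.
split=> // [|j sj].
  by have := nth_find 0 hs; rewrite nth_iota// add0n => /asboolP.
rewrite leqNgt; apply/negP => jl; have := before_find 0 jl.
by rewrite nth_iota ?add0n ?asboolT// (ltn_trans jl).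
Qed.

Hypothesis Slex : forall j, lexmin k S j (c_ j).
Hypothesis Esym : forall x y, edge S x y -> edge S y x.

(** The bound is (s + 1)(k - 1) + 1: the shared color 0 and s + 1 blocks of k - 1 colors. That k is
    positive follows from the color of [y] being below k. *)
Lemma col_lt y : dom S y -> (exists2 j, j <= s & part S j y) ->
  col y < k * (s + 1) - s.
Proof.
move=> Vy /levelP[le_s _ _]; have [[ck _] _] := Slex (level y).
have := ck y Vy; rewrite /col; case: ifP => _; nia.
Qed.

Lemma col_proper x y : dom S x -> dom S y -> edge S x y ->
  (exists2 j, j <= s & part S j x) -> (exists2 j, j <= s & part S j y) ->
  col x <> col y.
Proof.
move=> Vx Vy Exy /levelP[_ selx minx] /levelP[_ sely miny].
have sel_nbhd j z : sel j z -> nbhd S j z.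
  by case=> [?|[u [? ? ? _]]]; [left|right; exists u].
have differ j u v : dom S u -> dom S v -> edge S u v -> sel j u -> sel j v ->
    c_ j u <> c_ j v.
  by move=> Vu Vv Euv su sv; apply: (Slex j).1.2 => //; exact: sel_nbhd.
(* A neighbor in the part with color 0 would clash with [z], which also has color 0; so [z] is
   selected by lying in the part itself. *)
have own z : dom S z -> sel (level z) z -> c_ (level z) z = 0 ->
    part S (level z) z.
  move=> Vz sz cz; case: (sz) => // -[u [Vu Euz Uu cu]].
  by case: (differ (level z) u z Vu Vz Euz _ sz); [left|rewrite cu cz].
have := differ (level x) x y Vx Vy Exy selx.
rewrite /col; case: (eqVneq _ 0) => cx; case: (eqVneq _ 0) => cy.
(* Each vertex lies in its own part with color 0, so it selects the other one at its own level;
   minimality of both levels makes them equal. *)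
- have Ux := own x Vx selx cx; have Uy := own y Vy sely cy.
  have xy : level x = level y.
    apply/eqP; rewrite eqn_leq minx ?miny//; right; [exists x|exists y]; split=> //.
    exact: Esym.
  by rewrite xy cy -xy cx => /(_ (or_introl _)); case; rewrite // xy.
- by move=> _ /esym/eqP; rewrite addn_eq0 (negbTE cy) andbF.
- by move=> _ /eqP; rewrite addn_eq0 (negbTE cx) andbF.
have [[ckx _] _] := Slex (level x); have [[cky _] _] := Slex (level y).
have := ckx x Vx; have := cky y Vy; move=> ly lx dif e.
(* Both colors are nonzero, and the blocks of nonzero colors of distinct levels are disjoint. *)
have xy : level x = level y by nia.
by move: dif; rewrite xy => /(_ sely); apply; move: e; rewrite xy => /addnI.
Qed.

End Color.

(** The color of [y] consults the least colorings only at [y] and at its neighbors in the part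
    concerned, so agreement there suffices. *)
Lemma col_agree k s T (E L : T -> T -> Prop) U (V V' : T -> Prop) y :
  (forall z, E z y -> V z /\ V' z) -> (exists2 j, j <= s & U j y) ->
  (forall j z, j <= s -> U j z -> z = y \/ E z y -> forall w, w = z \/ w = y ->
    lexcol k (CStruct V E L U) j w = lexcol k (CStruct V' E L U) j w) ->
  col k s (CStruct V E L U) y = col k s (CStruct V' E L U) y.
Proof.
move=> VV' Uy agree; set S := CStruct V E L U; set S' := CStruct V' E L U.
have selE j : j <= s -> sel k S j y <-> sel k S' j y.
  move=> js; split=> -[?|[x [/= Vx Exy Ux cx]]]; (try by left); right; exists x.
    split=> //=; first by have [] := VV' _ Exy.
    by rewrite -(agree j x) //; [right|left].
  split=> //=; first by have [] := VV' _ Exy.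
  by rewrite (agree j x) //; [right|left].
have lev : level k s S y = level k s S' y.
  apply: eq_in_find => j; rewrite mem_iota add0n ltnS /= => js.
  exact: asbool_equiv_eq (selE j js).
have [ls sl _] := @levelP k s T S y Uy.
rewrite /col -lev (_ : lexcol k S _ y = lexcol k S' (level k s S y) y)//.
case: sl => [Ul|[z [/= _ Ezy Uz _]]]; first by apply: (agree _ y) => //; left.
by apply: (agree _ z) => //; right.
Qed.

(** * Invariance under isomorphism *)

Section Transport.
Variables (k s : nat).

(** The maps are total but inverse to each other only on the domains, so that [nat] can carry a
    finite structure. Parts are compared only up to index [s]: on codes, index [s.+1] holds the set
    to be colored. *)
Record siso T T' (S : cstruct T) (S' : cstruct T') (e : T -> T') (f : T' -> T) :
    Prop := SIso {
  siso_dom : forall t, dom S t -> dom S' (e t);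
  siso_dom' : forall t, dom S' t -> dom S (f t);
  sisoK : forall t, dom S t -> f (e t) = t;
  sisoK' : forall t, dom S' t -> e (f t) = t;
  siso_edge : forall u v, dom S u -> dom S v -> edge S u v <-> edge S' (e u) (e v);
  siso_ord : forall u v, dom S u -> dom S v -> ord S u v <-> ord S' (e u) (e v);
  siso_part : forall j u, j <= s -> dom S u -> part S j u <-> part S' j (e u) }.

Lemma siso_sym T T' (S : cstruct T) (S' : cstruct T') e f :
  siso S S' e f -> siso S' S f e.
Proof.
case=> h1 h2 h3 h4 h5 h6 h7; split=> //.
- by move=> u v Vu Vv; rewrite h5 ?h4//; exact: h2.
- by move=> u v Vu Vv; rewrite h6 ?h4//; exact: h2.
- by move=> j u js Vu; rewrite h7 ?h4//; exact: h2.
Qed.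

(** The point [t0] is the value of the inverse map outside the domain of [S']. *)
Lemma bij_siso T T' (S : cstruct T) (S' : cstruct T') (e : T -> T') t0 : dom S t0 ->
  (forall t, dom S t -> dom S' (e t)) ->
  (forall t', dom S' t' -> exists2 t, dom S t & e t = t') ->
  (forall t u, dom S t -> dom S u -> e t = e u -> t = u) ->
  (forall u v, dom S u -> dom S v -> edge S u v <-> edge S' (e u) (e v)) ->
  (forall u v, dom S u -> dom S v -> ord S u v <-> ord S' (e u) (e v)) ->
  (forall j u, j <= s -> dom S u -> part S j u <-> part S' j (e u)) ->
  exists f, siso S S' e f.
Proof.
move=> Vt0 h1 surj inj h5 h6 h7.
have ex t' : exists t, dom S' t' -> dom S t /\ e t = t'.
  have [/surj[t Vt et]|nV] := pselect (dom S' t'); first by exists t.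
  by exists t0.
have [f fP] := choice ex.
exists f; split=> // t Vt; [by have [] := fP t Vt| |by have [] := fP t Vt].
by have [? ?] := fP _ (h1 t Vt); exact: inj.
Qed.

Lemma siso_ord_min T T' (S : cstruct T) (S' : cstruct T') e f :
  siso S S' e f -> ord_min S -> ord_min S'.
Proof.
move=> iso Smin P [v' Vv' Pv'].
have [|w [Vw Pw wmin]] := Smin (P \o e).
  by exists (f v'); [exact: (siso_dom' iso)|rewrite /= (sisoK' iso)].
exists (e w); split=> // [|u Vu Pu]; first exact: (siso_dom iso).
move=> Lu; apply: (wmin (f u)); rewrite /= ?(sisoK' iso)//.
  exact: (siso_dom' iso).
by apply/(siso_ord iso) => //; [exact: (siso_dom' iso)|rewrite (sisoK' iso)].
Qed.

Lemma siso_nbhd T T' (S : cstruct T) (S' : cstruct T') e f j u :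
  siso S S' e f -> j <= s -> dom S u -> nbhd S j u -> nbhd S' j (e u).
Proof.
move=> iso js Vu [Uu|[x [Vx Exu Ux]]]; first by left; apply/(siso_part iso).
right; exists (e x); split; first exact: (siso_dom iso).
  exact/(siso_edge iso).
exact/(siso_part iso).
Qed.

Lemma siso_good T T' (S : cstruct T) (S' : cstruct T') e f j c :
  siso S S' e f -> j <= s -> good k S' j c -> good k S j (c \o e).
Proof.
move=> iso js [ck cE]; split=> [v Vv|u v Vu Vv Euv Nu Nv].
  exact/ck/(siso_dom iso).
apply: cE; [exact: (siso_dom iso)|exact: (siso_dom iso)| |exact: (siso_nbhd iso)|
  exact: (siso_nbhd iso)].
exact/(siso_edge iso).
Qed.

Lemma siso_lexmin T T' (S : cstruct T) (S' : cstruct T') e f j c :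
  siso S S' e f -> j <= s -> lexmin k S' j c -> lexmin k S j (c \o e).
Proof.
move=> iso js [gc cmin]; split; first exact: (siso_good iso js gc).
move=> d gd v Vv lt_v.
have gdf := siso_good (siso_sym iso) js gd.
have [|u [Vu Lu du]] := cmin _ gdf _ (siso_dom iso Vv).
  by rewrite /= (sisoK iso).
have Vfu := siso_dom' iso Vu.
exists (f u); split=> //; last by rewrite /= (sisoK' iso).
by apply/(siso_ord iso) => //; rewrite (sisoK' iso).
Qed.

(** A least coloring pulls back to a least coloring, which is unique on the domain. If one structure
    has none, neither has the other, and both sides are 0. *)
Lemma siso_lexcol T T' (S : cstruct T) (S' : cstruct T') e f j t :
  siso S S' e f -> ord_min S -> (forall x y, edge S x y -> edge S y x) ->
  j <= s -> dom S t -> lexcol k S j t = lexcol k S' j (e t).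
Proof.
move=> iso Smin Esym js Vt.
have [h|h] := pselect (exists c, lexmin k S' j c).
  have hc := siso_lexmin iso js (lexcolP h).
  by apply: (lexmin_unique Smin Esym _ hc) => //; apply: lexcolP; eexists; exact: hc.
rewrite /lexcol; case: pselect => [[c hc]|_]; case: pselect => // _.
by case: h; eexists; exact: (siso_lexmin (siso_sym iso) js hc).
Qed.

Lemma siso_col T T' (S : cstruct T) (S' : cstruct T') e f t :
  siso S S' e f -> ord_min S -> (forall x y, edge S x y -> edge S y x) ->
  (exists2 j, j <= s & part S j t) ->
  dom S t -> col k s S t = col k s S' (e t).
Proof.
move=> iso Smin Esym Ut Vt.
have lexE := siso_lexcol iso Smin Esym.
have lev : level k s S t = level k s S' (e t).
  apply: eq_in_find => j; rewrite mem_iota add0n ltnS /= => js.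
  apply: asbool_equiv_eq; split=> -[Uj|[x [Vx Ex Ux cx]]].
  - by left; apply/(siso_part iso).
  - right; exists (e x); split; [exact: (siso_dom iso)| | |by rewrite -lexE].
      exact/(siso_edge iso).
    exact/(siso_part iso).
  - by left; apply/(siso_part iso).
  - have Vfx := siso_dom' iso Vx.
    right; exists (f x); split=> //.
    + by apply/(siso_edge iso) => //; rewrite (sisoK' iso).
    + by apply/(siso_part iso) => //; rewrite (sisoK' iso).
    + by rewrite lexE// (sisoK' iso).
by have [ls _ _] := @levelP k s T S t Ut; rewrite /col -lev lexE.
Qed.

End Transport.

(** * The algorithm on codes *)

Ltac recstep :=
  lazymatch goal with
  | |- recfun _ (fun v => nat_of_bool (andb (@?p v) (@?q v))) => apply: recpred_and
  | |- recfun _ (fun v => nat_of_bool (orb (@?p v) (@?q v))) => apply: recpred_or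
  | |- recfun _ (fun v => nat_of_bool (implb (@?p v) (@?q v))) => apply: recpred_imply
  | |- recfun _ (fun v => nat_of_bool (negb (@?p v))) => apply: recpred_not
  | |- recfun _ (fun v => nat_of_bool (leq (@?p v) (@?q v))) => apply: recpred_leq
  | |- recfun _ (fun v => nat_of_bool (eq_op (@?p v) (@?q v))) => apply: recpred_eq
  | |- recfun _ (fun v => nat_of_bool (hf_mem (@?p v) (@?q v))) =>
      apply: recpred_hf_mem
  | |- recfun _ (fun v => nat_of_bool (has (@?p v) (@?q v))) => apply: recpred_has
  | |- recfun _ (fun v => nat_of_bool (all (@?p v) (@?q v))) => apply: recpred_all
  | |- recfun _ (fun v => find (@?p v) (@?q v)) => apply: recfun_find
  | |- recfun _ (fun v => S (@?p v)) => apply: recfun_succ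
  | |- recfun _ (fun v => (@?p v) + (@?q v)) => apply: recfun_add
  | |- recfun _ (fun v => (@?p v) * (@?q v)) => apply: recfun_mul
  | |- recfun _ (fun v => (@?p v) ^ (@?q v)) => apply: recfun_exp
  | |- recfun _ (fun v => hf_pair (@?p v) (@?q v)) => apply: recfun_hf_pair
  | |- recfun _ (fun v => hf_nat (@?p v)) => apply: recfun_hf_nat
  | |- recfun _ (fun v => hf_fst (@?p v)) => apply: recfun_hf_fst
  | |- recfun _ (fun v => hf_snd (@?p v)) => apply: recfun_hf_snd
  | |- recfun _ (fun v => digit _ (@?p v) (@?q v)) => apply: recfun_digit
  | |- recfun _ (head 0) => rvar
  | |- recfun _ (fun v => head 0 _) => rvar
  | |- recfun _ (fun v => _) => exact: recfun_const
  end.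

(** * The coloring computed on codes by bounded search *)

Section Code.
Variables (k s : nat).
Implicit Types x j d u y : nat.
Local Notation dig := (digit k.+1).

(** Layout of [code_input]: entry 0 is the pair of vertex set and edge set, entry 1 the order,
    entries 2 to s + 2 the parts, and entry s + 3 the set to be colored, read as part s + 1. *)
Definition code_dom x := hf_fst (hf_fst x).
Definition code_edge x := hf_snd (hf_fst x).
Definition code_ord x := hf_fst (hf_snd x).
Definition code_part x j := hf_fst (iter j.+2 hf_snd x).
Definition code_set x := code_part x s.+1.

Definition code_struct x : cstruct nat :=
  CStruct (fun v => hf_mem v (code_dom x))
    (fun u v => hf_mem (hf_pair u v) (code_edge x))
    (fun u v => hf_mem (hf_pair u v) (code_ord x))
    (fun j v => hf_mem v (code_part x j)).

(** Vertices are smaller than the code [x] of the structure, by [code_dom_lt], so [x] bounds all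
    quantifiers over vertices. *)
Definition nbhdb x j u :=
  hf_mem u (code_part x j) ||
  has (fun y => [&& hf_mem y (code_dom x), hf_mem (hf_pair y u) (code_edge x)
    & hf_mem y (code_part x j)]) (iota 0 x).

(** Base k + 1 stays positive for k = 0; that the colors are below k is tested separately. *)
Definition goodb x j d :=
  all (fun v => hf_mem v (code_dom x) ==> (dig d v < k)) (iota 0 x) &&
  all (fun u => all (fun v =>
    [&& hf_mem u (code_dom x), hf_mem v (code_dom x),
        hf_mem (hf_pair u v) (code_edge x), nbhdb x j u & nbhdb x j v] ==>
    (dig d u != dig d v)) (iota 0 x)) (iota 0 x).

Definition lexminb x j d :=
  goodb x j d && all (fun d' => goodb x j d' ==>
    all (fun v => hf_mem v (code_dom x) && (dig d' v < dig d v) ==>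
      has (fun u => [&& hf_mem u (code_dom x), hf_mem (hf_pair u v) (code_ord x)
        & dig d' u != dig d u]) (iota 0 x)) (iota 0 x)) (iota 0 (k.+1 ^ x)).

Definition lexfind x j := find (lexminb x j) (iota 0 (k.+1 ^ x)).

(** A failed search returns [k.+1 ^ x]. It is replaced by 0, whose digits are all 0, in accordance
    with the default of [lexcol]. *)
Definition lexcode x j := if lexfind x j < k.+1 ^ x then lexfind x j else 0.

Definition selb x j y :=
  hf_mem y (code_part x j) ||
  has (fun z => [&& hf_mem z (code_dom x), hf_mem (hf_pair z y) (code_edge x),
    hf_mem z (code_part x j) & dig (lexcode x j) z == 0]) (iota 0 x).

Definition levelb x y := find (fun j => selb x j y) (iota 0 s.+1).

Definition colb x y :=
  if dig (lexcode x (levelb x y)) y == 0 then 0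
  else levelb x y * k.-1 + dig (lexcode x (levelb x y)) y.

(** The Ackermann code of the graph of the coloring on [code_set]. *)
Definition outb x := \sum_(v <- iota 0 x)
  if hf_mem v (code_set x) then 2 ^ hf_pair v (hf_nat (colb x v)) else 0.

Lemma recfun_code_part n p q : recfun n p -> recfun n q ->
  recfun n (fun v => code_part (p v) (q v)).
Proof.
move=> hp hq; apply/recfun_hf_fst/recfun_iter => //; last by do 2!apply: recfun_succ.
by apply: recfun_hf_snd; rvar.
Qed.

Lemma recpred_nbhdb n p q r : recfun n p -> recfun n q -> recfun n r ->
  recpred n (fun v => nbhdb (p v) (q v) (r v)).
Proof.
apply: (@recfun3 _ (fun a b c => nat_of_bool (nbhdb a b c))).
by rewrite /nbhdb /code_dom /code_edge;
  repeat first [recstep | apply: recfun_code_part].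
Qed.

Lemma recpred_goodb n p q r : recfun n p -> recfun n q -> recfun n r ->
  recpred n (fun v => goodb (p v) (q v) (r v)).
Proof.
apply: (@recfun3 _ (fun a b c => nat_of_bool (goodb a b c))).
by rewrite /goodb /code_dom /code_edge; repeat first [recstep | apply: recpred_nbhdb].
Qed.

Lemma recfun_lexcode n p q : recfun n p -> recfun n q ->
  recfun n (fun v => lexcode (p v) (q v)).
Proof.
have h m p' q' : recfun m p' -> recfun m q' ->
    recfun m (fun v => lexfind (p' v) (q' v)).
  apply: (@recfun2 _ lexfind); rewrite /lexfind /lexminb /code_dom /code_ord.
  by repeat first [recstep | apply: recpred_goodb].
move=> hp hq; apply: recfun_if; [|exact: h|exact: recfun_const].
by apply: recpred_leq; [apply: recfun_succ; exact: h|repeat first [recstep | by []]].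
Qed.

Lemma recfun_colb n p q : recfun n p -> recfun n q ->
  recfun n (fun v => colb (p v) (q v)).
Proof.
have lv m p' q' : recfun m p' -> recfun m q' ->
    recfun m (fun v => levelb (p' v) (q' v)).
  apply: (@recfun2 _ levelb); rewrite /levelb /selb /code_dom /code_edge.
  by repeat first [recstep | apply: recfun_code_part | apply: recfun_lexcode].
apply: (@recfun2 _ colb); rewrite /colb.
have hd : recfun 2 (fun v => dig (lexcode (head 0 v)
    (levelb (head 0 v) (head 0 (behead v)))) (head 0 (behead v))).
  by repeat first [recstep | apply: recfun_lexcode | apply: (lv)].
apply: recfun_if; [|exact: recfun_const|].
  by apply: recpred_eq => //; exact: recfun_const.
by apply: recfun_add => //; repeat first [recstep | apply: (lv)].
Qed.

Lemma recfun_outb : recfun 1 (fun v => outb (head 0 v)).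
Proof.
apply: recfun_sum; first rvar.
apply: recfun_if; last exact: recfun_const.
  by repeat first [recstep | apply: recfun_code_part].
by repeat first [recstep | apply: recfun_colb].
Qed.

Lemma hf_proj_le p : hf_fst p <= p /\ hf_snd p <= p.
Proof.
by split; rewrite -[X in _ <= X](size_iota 0 p); exact: find_size.
Qed.

Lemma code_dom_lt x v : hf_mem v (code_dom x) -> v < x.
Proof.
move=> /hf_mem_lt lt_v; apply: leq_trans lt_v _.
exact: leq_trans (hf_proj_le (hf_fst x)).1 (hf_proj_le x).1.
Qed.

Lemma eq_good T (S : cstruct T) j c c' : (forall v, dom S v -> c v = c' v) ->
  good k S j c -> good k S j c'.
Proof.
by move=> e [ck cE]; split=> [v Vv|u v Vu Vv]; rewrite -!e//; [exact: ck|exact: cE].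
Qed.

(** * Agreement of the searches with their mathematical meaning *)

Section Correct.
Variable x : nat.
Let S := code_struct x.
Hypotheses (Smin : ord_min S) (Esym : forall u v, edge S u v -> edge S v u).

Let mem_x v : dom S v -> v \in iota 0 x.
Proof. by move=> /code_dom_lt; rewrite mem_iota. Qed.

Lemma nbhdP j u : nbhdb x j u <-> nbhd S j u.
Proof.
split=> [/orP[Uu|/hasP[y _ /and3P[Vy Ey Uy]]]|[Uu|[y [Vy Ey Uy]]]]; first by left.
- by right; exists y.
- by apply/orP; left.
- by apply/orP; right; apply/hasP; exists y; [exact: mem_x|apply/and3P].
Qed.

Lemma goodP j d : goodb x j d <-> good k S j (dig d).
Proof.
split=> [/andP[/allP ck /allP cE]|[ck cE]].
  split=> [v Vv|u v Vu Vv Euv /nbhdP Nu /nbhdP Nv].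
    exact: (implyP (ck _ (mem_x Vv))).
  have /allP cEu := cE _ (mem_x Vu).
  by apply/eqP/(implyP (cEu _ (mem_x Vv)))/and5P.
apply/andP; split; apply/allP => u _; first by apply/implyP; exact: ck.
apply/allP => v _; apply/implyP => /and5P[Vu Vv Euv /nbhdP Nu /nbhdP Nv].
by apply/eqP/cE.
Qed.

Lemma good_digits j c : good k S j c ->
  exists2 d, d < k.+1 ^ x & forall v, dom S v -> dig d v = c v.
Proof.
(* Outside the domain [c] is unbounded, so it is replaced by 0 to become a sequence of digits. *)
move=> [ck _]; pose f v := if hf_mem v (code_dom x) then c v else 0.
have [||d ld dP] := @digits_surj k.+1 x f => //.
  by move=> z _; rewrite /f; case: ifP => // /ck /leqW.
by exists d => // v Vv; rewrite dP ?(code_dom_lt Vv)// /f (_ : hf_mem _ _ = true).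
Qed.

Lemma lexminP j d : lexminb x j d <-> lexmin k S j (dig d).
Proof.
split=> [/andP[/goodP gd /allP dmin]|[gd dmin]].
  (* The competitor [c] is an arbitrary function; some [d'] within the search range has digits equal
     to it on the domain. *)
  split=> // c gc v Vv lt_v; have [d' ld' d'P] := good_digits gc.
  have gd' : goodb x j d' by apply/goodP; apply: eq_good gc => u /d'P.
  have /dmin/implyP/(_ gd')/allP/(_ v (mem_x Vv)) : d' \in iota 0 (k.+1 ^ x).
    by rewrite mem_iota.
  rewrite d'P// lt_v andbT => /implyP/(_ Vv)/hasP[u _ /and3P[Vu Lu du]]; exists u; split=> //.
  by rewrite -d'P//; exact/eqP.
apply/andP; split; first exact/goodP.
apply/allP => d' _; apply/implyP => /goodP gd'; apply/allP => v _.
apply/implyP => /andP[Vv lt_v]; have [u [Vu Lu du]] := dmin _ gd' _ Vv lt_v.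
by apply/hasP; exists u; [exact: mem_x|apply/and3P; split=> //; exact/eqP].
Qed.

Lemma lexcodeP j v : dom S v -> dig (lexcode x j) v = lexcol k S j v.
Proof.
move=> Vv; rewrite /lexcode.
have findP : (lexfind x j < k.+1 ^ x) = has (lexminb x j) (iota 0 (k.+1 ^ x)).
  by rewrite has_find size_iota.
case: ifP => [lt_f|].
  have hs : has (lexminb x j) (iota 0 (k.+1 ^ x)) by rewrite -findP.
  have := nth_find 0 hs; rewrite nth_iota// add0n => /lexminP hm.
  by apply: (lexmin_unique Smin Esym hm) => //; apply: lexcolP; eexists; exact: hm.
rewrite findP => /hasP nex; rewrite /lexcol; case: pselect => [[c hc]|_]; last first.
  by rewrite /digit div0n mod0n.
have [d ld dP] := good_digits hc.1; case: nex; exists d; first by rewrite mem_iota.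
apply/lexminP; split; first by apply: eq_good hc.1 => u /dP.
move=> c' gc' u Vu; rewrite dP// => lt_u.
by have [w [Vw Lw cw]] := hc.2 c' gc' u Vu lt_u; exists w; rewrite dP.
Qed.

Lemma colbP y : (exists2 j, j <= s & part S j y) -> dom S y ->
  colb x y = col k s S y.
Proof.
move=> Uy Vy; rewrite /colb /col.
have -> : levelb x y = level k s S y.
  apply: eq_find => j; apply/idP/asboolP.
    move=> /orP[?|/hasP[z _ /and4P[Vz Ez Uz /eqP cz]]]; first by left.
    by right; exists z; split; rewrite // -lexcodeP.
  move=> [Uj|[z [Vz Ez Uz cz]]]; apply/orP; first by left.
  right; apply/hasP; exists z; first exact: mem_x.
  by apply/and4P; split; rewrite ?lexcodeP//; exact/eqP.
by rewrite !lexcodeP.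
Qed.

End Correct.
End Code.

(** * The algorithm, its invariance and its computability *)

Section Algorithm.
Variables (k s : nat).

Definition input_struct (I : asi_input s) : cstruct I :=
  CStruct (fun=> True) (@adj I) (@ai_lt _ I) (fun j => ai_part (inord j)).

Lemma input_ord_min (I : asi_input s) : ord_min (input_struct I).
Proof.
apply: finite_ord_min; last exact: ai_linear.
by apply: sub_finite_set (ai_finite I) => x.
Qed.

Lemma input_part (I : asi_input s) (x : I) :
  exists2 j, j <= s & part (input_struct I) j x.
Proof.
have [[j js] Uj] := (ai_partP I).1 x; exists j; first by rewrite -ltnS.
by rewrite /= (_ : inord j = Ordinal js)//; apply: val_inj; rewrite /= inordK.
Qed.

Fact lex_alg_invariant (I J : asi_input s) (phi : I -> J) : asi_iso phi ->
  forall (x : ai_set I) (y : ai_set J), val y = phi (val x) ->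
  hf_nat (col k s (input_struct I) (val x)) =
  hf_nat (col k s (input_struct J) (val y)).
Proof.
move=> [[[psi pK Kp] phiE] phiL phiU _] x y ->; congr hf_nat.
have iso : siso s (input_struct I) (input_struct J) phi psi.
  by split=> //=.
apply: (siso_col k iso) => //; first exact: input_ord_min.
  by move=> u v; exact: adj_sym.
exact: input_part.
Qed.

Definition lex_alg : asi_algorithm s := ASIAlgorithm lex_alg_invariant.

Lemma hf_tuple_proj (l : seq HF) j : j < size l ->
  hf_fst (iter j hf_snd (hf_tuple l)) = nth 0 l j.
Proof.
elim: l j => [|a l IH] [|j] //=; first by rewrite hf_fst_pair.
by rewrite ltnS -iterS iterSr hf_snd_pair; exact: IH.
Qed.

Section CodeInput.
Variables (I : asi_input s) (e : I -> HF).
Hypothesis e_inj : injective e.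
Let x := code_input e.
Let fin (A : set I) : finite_set A := sub_finite_set (@subsetT _ A) (ai_finite I).

Let hf_mem_img (A : set I) v : hf_mem v (hf_of (e @` A)) <-> exists2 t, A t & e t = v.
Proof. by rewrite hf_mem_of//; exact/finite_image/fin. Qed.

Let hf_mem_rel (P : I -> I -> Prop) u v :
  hf_mem (hf_pair (e u) (e v))
    (hf_of [set hf_pair (e p.1) (e p.2) | p in [set p | P p.1 p.2]]) <-> P u v.
Proof.
rewrite hf_mem_of; last first.
  apply/finite_image; apply: (@sub_finite_set _ _ (setT `*` setT)) => //.
  by apply: finite_setX; exact: fin.
split=> [[[a b] /= Pab /hf_pair_inj[/e_inj<- /e_inj<-]]//|Puv].
by exists (u, v).
Qed.

Lemma code_input_dom v : hf_mem v (code_dom x) <-> exists2 t, True & e t = v.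
Proof. by rewrite /code_dom !hf_fst_pair; exact: (hf_mem_img setT). Qed.

Lemma code_input_edge u v :
  hf_mem (hf_pair (e u) (e v)) (code_edge x) <-> adj u v.
Proof. by rewrite /code_edge hf_fst_pair hf_snd_pair; exact: (hf_mem_rel (@adj I)). Qed.

Lemma code_input_ord u v :
  hf_mem (hf_pair (e u) (e v)) (code_ord x) <-> ai_lt u v.
Proof. by rewrite /code_ord hf_snd_pair hf_fst_pair; exact: (hf_mem_rel (@ai_lt _ I)). Qed.

Lemma code_input_part j v : j <= s ->
  hf_mem v (code_part x j) <-> exists2 t, ai_part (inord j) t & e t = v.
Proof.
move=> js; have szj : size (enum 'I_s.+1) = s.+1 by rewrite size_enum_ord.
rewrite /code_part hf_tuple_proj; last first.
  by rewrite /= size_cat size_map szj /=; lia.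
rewrite /= nth_cat size_map szj ltnS js (nth_map ord0) ?szj//.
rewrite (_ : nth _ _ _ = inord j); first exact: hf_mem_img.
by apply: val_inj; rewrite /= nth_enum_ord ?inordK.
Qed.

Lemma code_input_set v :
  hf_mem v (code_set s x) <-> exists2 t, ai_set I t & e t = v.
Proof.
have szj : size (enum 'I_s.+1) = s.+1 by rewrite size_enum_ord.
rewrite /code_set /code_part hf_tuple_proj; last first.
  by rewrite /= size_cat size_map szj /=; lia.
by rewrite /= nth_cat size_map szj ltnn subnn; exact: hf_mem_img.
Qed.

Lemma code_input_siso (t0 : I) :
  exists f, siso s (input_struct I) (code_struct x) e f.
Proof.
apply: (@bij_siso _ _ _ _ _ _ t0) => //=.
- by move=> t _; apply/code_input_dom; exists t.
- by move=> t' /code_input_dom.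
- by move=> t u _ _ /e_inj.
- by move=> u v _ _; rewrite code_input_edge.
- by move=> u v _ _; rewrite code_input_ord.
- move=> j u js _; rewrite code_input_part//; split=> [Uu|[t Ut /e_inj<-]//].
  by exists u.
Qed.

Lemma code_input_col (t : I) : colb k s x (e t) = col k s (input_struct I) t.
Proof.
have [f iso] := code_input_siso t.
(* Every pair in the coded edge set comes from an edge of [I], so symmetry holds for all numbers and
   not just for codes of vertices. *)
have Esym (u v : nat) : edge (code_struct x) u v -> edge (code_struct x) v u.
  move=> Euv; apply: contrapT => nE; move: Euv.
  rewrite /= /code_edge hf_fst_pair hf_snd_pair hf_mem_of; last first.
    apply/finite_image; apply: (@sub_finite_set _ _ (setT `*` setT)) => //.
    by apply: finite_setX; exact: fin.
  move=> [[a b] /= ab /hf_pair_inj[au bv]]; apply: nE.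
  by rewrite /= -au -bv code_input_edge; exact: adj_sym.
have Ut := input_part t.
rewrite colbP//.
- rewrite -(siso_col k iso)//; first exact: input_ord_min.
  by move=> u v; exact: adj_sym.
- exact: siso_ord_min iso (@input_ord_min I).
- by have [j js Uj] := Ut; exists j => //; apply/(siso_part iso).
- exact: (siso_dom iso).
Qed.

(** Pairing is injective, so the powers of 2 summed by [outb] are distinct bits, and they are
    indexed exactly by the elements of the output set. *)
Lemma outb_code_input : outb k s x = code_output e (@lex_alg I).
Proof.
pose F v := hf_pair v (hf_nat (colb k s x v)).
have F_inj : injective F by move=> u v /hf_pair_inj[].
rewrite /outb -big_mkcond -big_filter.
rewrite -(big_map F predT (fun z => 2 ^ z)).
rewrite /code_output; apply/esym/hf_of_seq.
  by rewrite map_inj_uniq// filter_uniq// iota_uniq.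
move=> z; split.
  move=> [t _ <-]; apply/mapP; exists (e (val t)); last first.
    by rewrite /F code_input_col.
  rewrite mem_filter mem_iota add0n; apply/andP; split.
    by apply/code_input_set; exists (val t) => //; exact: set_valP.
  by apply: code_dom_lt; apply/code_input_dom; exists (val t).
move=> /mapP[v]; rewrite mem_filter => /andP[/code_input_set[t At <-] _] ->.
exists (exist (fun y => y \in ai_set I) t (mem_set At)) => //.
by rewrite /F code_input_col.
Qed.

End CodeInput.

Lemma lex_alg_computable : computable lex_alg.
Proof.
have [f hf] := recfun_outb k s; exists f => I e e_inj.
by have := hf [tuple code_input e]; rewrite /= outb_code_input.
Qed.

End Algorithm.

(** * Correctness on windows *)

Lemma rho_le_trans (G : graph) m n (x y z : G) :
  rho_le m x y -> rho_le n y z -> rho_le (m + n) x z.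
Proof.
move=> /rho_leP[a am xy] /rho_leP[b bn yz]; apply/rho_leP.
by exists (a + b); [exact: leq_add|exact: walk_cat yz].
Qed.

Lemma rho_le_widen (G : graph) m n (x y : G) : m <= n -> rho_le m x y -> rho_le n x y.
Proof.
by move=> mn /rho_leP[a am xy]; apply/rho_leP; exists a => //; exact: leq_trans mn.
Qed.

Lemma rho_le_adj (G : graph) (x y : G) : adj x y -> rho_le 1 x y.
Proof. by move=> xy; apply/rho_leP; exists 1 => //; exists y. Qed.

Lemma hf_nat_inj : injective hf_nat.
Proof.
have h : {homo hf_nat : i j / i < j}.
  apply: homo_ltn => [y x z|i]; first exact: ltn_trans.
  by rewrite hf_natS -[X in X < _]addn0 ltn_add2l expn_gt0.
by move=> i j ij; case: (ltngtP i j) => // /h; rewrite ij ltnn.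
Qed.

Section Windows.
Variables (k s : nat) (G : graph) (lt : G -> G -> Prop) (U : 'I_s.+1 -> set G).
Hypotheses (lfG : locally_finite G) (ltP : linear_order lt).
Hypotheses (UP : asi_witness 3 U) (kG : colorable k G).
Local Notation tilde := (tilde 3 U).
Local Notation win := (@window s 3 3 G U).
Implicit Types C D : tilde.

(** Points of [U j] at distance at most 3 are equal or adjacent in the third power restricted to
    [U j], whose components are the cells. *)
Lemma cell_close C x y j : (val C : set G) x -> U j x -> U j y ->
  rho_le 3 x y -> (val C : set G) y.
Proof.
case: C => C hC /=; have [i [D [cD ->]]] := set_mem hC.
move=> [x' Dx' xx'] Ux Uy xy.
have ij : i = j by apply: (UP.1.2 i j x) => //; rewrite -xx'; exact: set_valP.
subst i; exists (exist _ y (mem_set Uy)) => //.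
rewrite (component_eq cD Dx').
have [exy|nxy] := pselect (x = y).
  rewrite (_ : exist _ _ _ = x'); first exact: connected_refl.
  by apply: val_inj; rewrite /= xx'.
exists 1; eexists; split; last by [].
by rewrite /= xx'; split.
Qed.

Lemma cell_part C x y j : (val C : set G) x -> (val C : set G) y -> U j x -> U j y.
Proof.
case: C => C hC /=; have [i [D [cD ->]]] := set_mem hC.
move=> [x' _ xx'] [y' _ yy'] Ux.
have ij : i = j by apply: (UP.1.2 i j x) => //; rewrite -xx'; exact: set_valP.
by subst i; rewrite -yy'; exact: set_valP.
Qed.

Lemma cell_step C D x y : (val C : set G) x -> (val D : set G) y ->
  rho_le 3 x y -> rho_le 1 C D.
Proof.
move=> Cx Dy xy; have [->|CD] := pselect (C = D); first exact: rho_le_refl.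
by apply: rho_le_adj; split=> //; exists x, y.
Qed.

(** The vertex type of a window input depends on the cell. Describing windows as subsets of [G]
    makes [lexmin_agree] applicable to two of them; [asi_run_col] makes the passage. *)
Definition sub_struct (V : set G) : cstruct G :=
  CStruct V (@adj G) lt (fun j => U (inord j)).

Lemma sub_part V x : exists2 j, j <= s & part (sub_struct V) j x.
Proof.
have [[j js] Uj] := UP.1.1 x; exists j; first by rewrite -ltnS.
by rewrite /= (_ : inord j = Ordinal js)//; apply: val_inj; rewrite /= inordK.
Qed.

Lemma asi_run_col C x : (val C : set G) x ->
  asi_run 3 lfG ltP UP (lex_alg k s) x = hf_nat (col k s (sub_struct (win C)) x).
Proof.
move=> Cx; rewrite (asi_runE _ _ _ _ _ Cx) /=; congr hf_nat.
set I := window_input _ _ _ _ _.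
pose t : I := val (window_point 3 lfG ltP UP Cx).
have [||||||f iso] := @bij_siso s I G (input_struct I)
  (sub_struct (win C)) (fun y : I => val y) t Logic.I => //=.
- by move=> y _; exact: set_valP.
- by move=> y Wy; exists (exist _ y (mem_set Wy)).
- by move=> y z _ _; exact: val_inj.
apply: (siso_col k iso) => //; first exact: input_ord_min.
  by move=> u v; exact: adj_sym.
exact: input_part.
Qed.

Lemma win_ord_min C : ord_min (sub_struct (win C)).
Proof. by apply: finite_ord_min => //; exact: window_finite. Qed.

Lemma win_lexmin C j :
  lexmin k (sub_struct (win C)) j (lexcol k (sub_struct (win C)) j).
Proof.
apply/lexcolP/finite_lexmin => //; first exact: window_finite.
have [c pc] := kG; exists c; split=> // u v _ _ /pc cuv _ _ e.
by apply: cuv; exact: val_inj.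
Qed.

(* Distinct cells of [U j] are at distance more than 3, so no edge joins the
   neighborhoods of two of them: lexicographic minimality can then be tested on
   the neighborhood of [D] alone, which does not depend on the window. *)
Lemma lexcol_win_agree C C' D j z w : rho_le 2 C D -> rho_le 2 C' D ->
  (val D : set G) z -> U (inord j) z -> (val D : set G) w \/ adj z w ->
  lexcol k (sub_struct (win C)) j w = lexcol k (sub_struct (win C')) j w.
Proof.
move=> CD CD' Dz Uz hw.
pose X v := (val D : set G) v \/ exists2 x, (val D : set G) x & adj x v.
have near v : X v -> exists2 x, (val D : set G) x & rho_le 1 x v.
  by case=> [Dv|[x Dx xv]]; [exists v => //; exact: rho_le_refl|
    exists x => //; exact: rho_le_adj].
(* The radius 3 is spent here: a cell meeting the neighborhood of [D] is within 1 of [D], hence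
   within 3 of [B]. *)
have XW B : rho_le 2 B D -> forall v, X v -> win B v.
  move=> BD v /near[x Dx xv]; have [F Fv] := cells_cover UP v.
  exists F => //; apply: (rho_le_trans BD); apply: cell_step Dx Fv _.
  exact: rho_le_widen xv.
have XN B : rho_le 2 B D -> forall v, X v -> nbhd (sub_struct (win B)) j v.
  move=> BD v [Dv|[x Dx xv]]; first by left; exact: cell_part Dz Dv Uz.
  right; exists x; split=> //=; last exact: cell_part Dz Dx Uz.
  by apply: XW => //; left.
(* The scale 3 is spent here: [x], [u], [v], [y] form a path of length at most 3 between points of
   part [j], so [y] lies in the cell [D] of [x]. *)
have cl B u v : X u -> win B v -> adj u v -> nbhd (sub_struct (win B)) j u ->
    nbhd (sub_struct (win B)) j v -> X v.
  move=> /near[x Dx xu] _ uv _.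
  have xv : rho_le 2 x v := rho_le_trans xu (rho_le_adj uv).
  have Ux := cell_part Dz Dx Uz.
  move=> [Uv|[y [_ yv Uy]]].
    by left; apply: cell_close Dx Ux Uv _; exact: rho_le_widen xv.
  right; exists y => //; apply: cell_close Dx Ux Uy _.
  exact: rho_le_trans xv (rho_le_adj (adj_sym yv)).
apply: (@lexmin_agree k G (@adj G) lt (fun j => U (inord j)) (@adj_sym G)
  (win C) (win C') X j _ _ (@win_ord_min C) (XW C CD) (XW C' CD') _
  (cl C) (cl C') (@win_lexmin C j) (@win_lexmin C' j)).
  by move=> u Xu; split=> _; exact: XN.
by case: hw => [Dw|zw]; [left|right; exists z].
Qed.

Lemma asi_run_lex_alg :
  proper_coloring (k * (s + 1) - s) (asi_run 3 lfG ltP UP (lex_alg k s)).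
Proof.
split=> [x|x y xy].
  have [C Cx] := cells_cover UP x; rewrite (asi_run_col Cx).
  apply/hf_mem_nat; eexists; last by [].
  apply: col_lt; [exact: win_lexmin| |exact: sub_part].
  exact: cell_sub_window.
have [C Cx] := cells_cover UP x; have [C' C'y] := cells_cover UP y.
have CC' : rho_le 1 C C'.
  by apply: cell_step Cx C'y _; exact: rho_le_widen (rho_le_adj xy).
rewrite (asi_run_col Cx) (asi_run_col C'y) => /hf_nat_inj.
(* The cells consulted for the color of [y] are within 1 of [C'] and, through the edge from [x] to
   [y], within 2 of [C], as [lexcol_win_agree] requires. *)
have step D z : (val D : set G) z -> z = y \/ adj z y ->
    rho_le 1 C' D /\ rho_le 2 C D.
  move=> Dz zy; have C'D : rho_le 1 C' D.
    apply: cell_step C'y Dz _; apply: rho_le_sym.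
    by case: zy => [->|/rho_le_adj]; [exact: rho_le_refl|exact: rho_le_widen].
  by split=> //; exact: rho_le_trans CC' C'D.
(* The color of [y] is recomputed in the window of [C], so that both colors come from one structure
   and [col_proper] applies. *)
rewrite -[in RHS](@col_agree k s G (@adj G) lt (fun j => U (inord j)) (win C)).
- apply: col_proper => //.
  + exact: win_lexmin.
  + by move=> u v; exact: adj_sym.
  + exact: cell_sub_window.
  + by exists C' => //; exact: rho_le_widen CC'.
  + exact: sub_part.
  + exact: sub_part.
- move=> z zy; have [D Dz] := cells_cover UP z.
  have [C'D CD] := step D z Dz (or_intror zy).
  by split; exists D => //; [exact: rho_le_widen CD|exact: rho_le_widen C'D].
- exact: (sub_part setT).
move=> j z _ Uz zy w wzy; have [D Dz] := cells_cover UP z.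
have [C'D CD] := step D z Dz zy.
apply: (lexcol_win_agree CD _ Dz Uz); first exact: rho_le_widen C'D.
by case: wzy zy => -> => [_|[<-|]]; [left|left|right].
Qed.

End Windows.

Theorem theorem3p2 (k s : nat) : ASI_c s (coloring k (k * (s + 1) - s)).
Proof.
exists (lex_alg k s), 3, 3; split; first exact: lex_alg_computable.
move=> G hG lt hlt U hU; apply: asi_run_lex_alg; exact: hG.2.
Qed.
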